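(* Let $n\in\mathbb{N}$, $\mu>0$ and $\omega\in[0,1]$. Let $C_i(k)$, $f_k(t)$, $g_k(t)$, $p_{k\ell}(t)$ be as defined in the context (dynamic appointment scheduling of $n$ clients with i.i.d. exponential service times of mean $1/\mu$). Then the $C_i(k)$ are determined recursively by: for $i=1,\ldots,n-1$ and $k=1,\ldots,i$, $$C_{i}(k) =\inf_{t\geqslant 0}\left(\omega\,f_k(t)+(1-\omega)\,g_k(t)+ \sum_{\ell=1}^{k+1} p_{k\ell}(t)\, C_{i+1}(\ell)\right),$$ whereas, for $k=1,\ldots,n$, $$C_{n}(k) =(1-\omega)\lim_{t\to\infty}g_k(t)=(1-\omega)\,\frac{k(k-1)}{2\mu}.$$
   Context: Model. Clients $1,\ldots,n$ arrive punctually, in this order, at a single server that serves them in order of arrival without idling when clients are present. Service times are independent and exponentially distributed with mean $1/\mu$. Immediately after the arrival of client $i<n$, the time $t\geqslant 0$ until the arrival of client $i+1$ is chosen as a function of $i$ and the number $k$ of clients then in the system (including the one just arrived and the one in service). A policy is a collection of such decision functions $\tau_j(\cdot)\geqslant 0$, $j=1,\ldots,n-1$. Cost. $C_i(k)$ is the infimum over policies of the expected cost incurred from the arrival of client $i$ onwards, given that immediately after this arrival there are $k$ clients in the system. The cost is $\omega$ times the total time the server is idle between the arrival of client $i$ and the arrival of client $n$, plus $(1-\omega)$ times the integral over time, from the arrival of client $i$ until all $n$ clients have left, of the number of waiting clients (clients present but not in service). Notation. For $m>0$ and integer $j$ let $F_{m}(j)=\mathbb{P}(\mathrm{Pois}(m)\leqslant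 j)$, where $\mathrm{Pois}(m)$ is Poisson with mean $m$ (so $F_m(j)=0$ for $j<0$); $F_0(j)=1$ for $j\geqslant 0$. For $k\geqslant 1$, $t\geqslant 0$, $$f_k(t) = t\,(1-F_{\mu t}(k-1))- \frac{k}{\mu}(1-F_{\mu t}(k)),$$ $$g_k(t)=(k-1)t\, F_{\mu t}( k-1)-\frac{\mu t^2}{2} F_{\mu t}(k-2)+\frac{k(k-1)}{2\mu} (1-F_{\mu t}(k)),$$ $$p_{k1}(t)= \sum_{m = k}^\infty e^{-\mu t}\frac{(\mu t)^m}{m !},\qquad p_{k\ell}(t)=e^{-\mu t}\frac{(\mu t)^{k-\ell+1}}{(k-\ell+1) !}\quad(\ell=2,\ldots,k+1).$$ *)

(* Defs.v *)
From HB Require Import structures.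
From mathcomp Require Import all_boot all_order all_algebra.
From mathcomp Require Import all_classical all_reals all_analysis.
Set Implicit Arguments.
Unset Strict Implicit.
Unset Printing Implicit Defensive.
Import Order.TTheory GRing.Theory Num.Theory.
Import numFieldNormedType.Exports.
Local Open Scope classical_set_scope.
Local Open Scope ring_scope.

Section Queue.
Context {R : realType}.
(* [tau j k] is the time between the arrivals of clients j and j+1 when k
   clients are present just after the arrival of client j; [b j] is the service
   time of client j.  Clients are numbered from 1, and client 1 arrives at time
   0 in an empty system. *)
Variables (tau : nat -> nat -> R) (b : nat -> R).

(* The arrival time of client j and the departure times of clients j, ..., 1. *)
Fixpoint schedule (j : nat) : R * seq R :=
  if j isn't j'.+1 then (0, [::]) else
  let: (a, ds) := schedule j' in
  let a' := if j' is 0%N then 0 else a + tau j' (count (> a) ds) in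
  (a', Num.max a' (head 0 ds) + b j :: ds).

Definition arrival (j : nat) : R := (schedule j).1.

Definition departure (j : nat) : R := head 0 (schedule j).2.

(* First come, first served, without idling; [departure 0 = 0]. *)
Definition service_start (j : nat) : R :=
  Num.max (arrival j) (departure j.-1).

(* The number of clients in the system just after the arrival of client j.
   Client j is always counted when [b] is positive; clients arriving later are
   not, even if they arrive at the same time. *)
Definition queue_length (j : nat) : nat :=
  count (fun l => arrival j < departure l) (iota 1 j).

Lemma arrival1 : arrival 1 = 0.
Proof. by []. Qed.

Lemma schedule2E j :
  (schedule j).2 = [seq departure l | l <- rev (iota 1 j)].
Proof.
elim: j => [//|j IHj].
rewrite -{2}addn1 iotaD rev_cat map_cat -IHj add1n /departure /=.
by case: (schedule j).
Qed.

Lemma arrivalS j : (0 < j)%N ->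
  arrival j.+1 = arrival j + tau j (queue_length j).
Proof.
move=> j_gt0; rewrite /arrival /=.
have := schedule2E j.
case E: (schedule j) => [a ds] /= dsE.
rewrite /queue_length /arrival E /=.
case: j j_gt0 E dsE => // j _ E ->.
by rewrite count_map count_rev.
Qed.

Lemma departureE j : (0 < j)%N -> departure j = service_start j + b j.
Proof.
case: j => // j _.
by rewrite /service_start /arrival /departure /=; case: (schedule j).
Qed.

Definition in_system (s : R) (l : nat) : bool := arrival l <= s < departure l.

Definition in_service (s : R) (l : nat) : bool :=
  service_start l <= s < departure l.

Definition server_idle (n : nat) (s : R) : bool :=
  ~~ has (in_service s) (iota 1 n).

Definition nb_waiting (n : nat) (s : R) : nat :=
  count (fun l => in_system s l && ~~ in_service s l) (iota 1 n).

Definition idle_time (n i : nat) : \bar R :=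
  lebesgue_measure [set s | arrival i <= s <= arrival n /\ server_idle n s].

(* The integrand vanishes once all n clients have left. *)
Definition total_waiting (n i : nat) : \bar R :=
  (\int[lebesgue_measure]_(s in `[arrival i, +oo[) (nb_waiting n s)%:R%:E)%E.

Definition cost (om : R) (n i : nat) : \bar R :=
  (om%:E * idle_time n i + (1 - om)%:E * total_waiting n i)%E.

End Queue.

Section Value.
Context {R : realType} {d : measure_display} {T : measurableType d}.
Variables (P : probability T R) (B : nat -> {RV P >-> R}).

Definition iid_exponential (n : nat) (mu : R) : Prop :=
  (forall j, (1 <= j <= n)%N -> forall A : set R, measurable A ->
     P (B j @^-1` A) = exponential_prob mu A) /\
  (forall (s : seq nat) (A : nat -> set R),
     uniq s -> (forall j, j \in s -> (1 <= j <= n)%N) ->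
     (forall j, measurable (A j)) ->
     P (\big[setI/setT]_(j <- s) (B j @^-1` A j)) =
     (\prod_(j <- s) P (B j @^-1` A j))%E).

(* Only the values [tau j k] with 1 <= k <= j < n matter. *)
Definition policy (tau : nat -> nat -> R) : Prop := forall j k, 0 <= tau j k.

Definition queue_event (tau : nat -> nat -> R) (i k : nat) : set T :=
  [set x | queue_length tau (fun j => B j x) i = k].

(* Conditional expectation given the event [queue_event tau i k]; meaningful
   only if this event has positive probability. *)
Definition expected_cost (om : R) (n : nat) (tau : nat -> nat -> R)
    (i k : nat) : \bar R :=
  ((fine (P (queue_event tau i k)))^-1%:E *
   \int[P]_(x in queue_event tau i k) cost tau (fun j => B j x) om n i)%E.

(* Policies under which the conditioning event has probability zero are
   discarded. *)
Definition optimal_cost (om : R) (n i k : nat) : \bar R :=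
  ereal_inf [set expected_cost om n tau i k |
    tau in [set tau | policy tau /\ (0 < P (queue_event tau i k))%E]].

End Value.

Section Formulas.
Context {R : realType}.
Variable mu : R.

(* P(Pois(m) <= j); the second argument of [poisson_prob] is a dummy. *)
Definition pois_cdf (m : R) (j : int) : R :=
  fine (poisson_prob m 0%N [set i : nat | (i%:Z <= j)%R]).

Local Notation F := (fun t => pois_cdf (mu * t)).

Definition f_ (k : nat) (t : R) : R :=
  t * (1 - F t (k%:Z - 1)) - k%:R / mu * (1 - F t k%:Z).

Definition g_ (k : nat) (t : R) : R :=
  (k%:R - 1) * t * F t (k%:Z - 1) - mu * t ^+ 2 / 2 * F t (k%:Z - 2)
  + k%:R * (k%:R - 1) / (2 * mu) * (1 - F t k%:Z).

Definition p_ (k l : nat) (t : R) : R :=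
  if l == 1%N
  then \big[+%R/0]_(k <= m <oo) (expR (- (mu * t)) * (mu * t) ^+ m / m`!%:R)
  else expR (- (mu * t)) * (mu * t) ^+ (k.+1 - l) / (k.+1 - l)`!%:R.

End Formulas.

(* Main.v *)
Require Import Defs.
From HB Require Import structures.
From mathcomp Require Import all_boot all_order all_algebra.
From mathcomp Require Import all_classical all_reals all_analysis.
From mathcomp Require Import measurable_realfun ring zify.
Set Implicit Arguments.
Unset Strict Implicit.
Unset Printing Implicit Defensive.
Import Order.TTheory GRing.Theory Num.Theory.
Import numFieldNormedType.Exports.
Local Open Scope classical_set_scope.
Local Open Scope ring_scope.

(** The queue length at successive arrivals is a controlled Markov chain. If k clients
    are present just after arrival j, client c = j-k+1 is in service; its elapsed
    service time X is determined by the earlier services, and past events only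
    constrain its service time by {X < B c}. By the memoryless property and
    independence, the residual times until the next k departures have Erlang tails
    F_{mu v}(m-1), whatever the past. Both parts of the cost between two arrivals at
    distance t are sums of truncated residuals, as
    idle time = t - min(t, Y_k) and waiting = sum_(m < k) min(t, Y_m), and
    E min(t, Y_m) is the integral over [0, t] of the Erlang tail: this gives f_k
    and g_k. The expected cost of a policy thus satisfies the recursion without
    infimum, and the theorem follows by choosing almost optimal interarrival
    times simultaneously in all states; interarrival times equal to 1 before client i
    make every state at arrival i reachable. *)

(** * Poisson weights and Erlang tails *)

Section poisson_calculus.
Context {R : realType}.
Implicit Types (m t s : R) (i j k : nat).

(** The Markov property is stated without conditional expectations: for every event H describing the
    past in state (j, k), the integral of the future cost over H is [P H] times a constant that
    depends on (j, k) only. Such identities add up over disjoint events, and the conditioning event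
    {Q i = k} is reached in this way, split along the successive queue lengths. The obstacle is that
    under an adaptive schedule an arrival time depends, through the queue lengths, on the service in
    progress. Once the successive queue lengths are fixed, the arrival times are constants and the
    elapsed service time depends on earlier services only. Hence the predicate [renewal], whose
    witnesses E and X are produced by induction on the arrivals, one queue length at a time. The
    sample-path identities rest on positive services. Positivity holds only almost surely and
    involves all n clients, not just the earlier ones, so it is carried apart as the event
    [positive_services], and events are compared on it. *)

Definition pois_wt m i : R := expR (- m) * m ^+ i / i`!%:R.
(** Has two roles: P(Pois(m) < k) and, at m = mu v, the tail P(Y_k > v) of a sum of k exponential
    services. The strict bound makes k the number of stages, with tail 0 for k = 0. *)
Definition pois_lt m k : R := \sum_(i < k) pois_wt m i.

Lemma pois_wt_ge0 m i : 0 <= m -> 0 <= pois_wt m i.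
Proof. by move=> m0; rewrite !mulr_ge0 ?expR_ge0 ?exprn_ge0. Qed.

Lemma pois_wt_gt0 m i : 0 < m -> 0 < pois_wt m i.
Proof. by move=> m0; rewrite !mulr_gt0 ?expR_gt0 ?exprn_gt0// invr_gt0 ltr0n fact_gt0. Qed.

Lemma mul_pois_wt m i : m * pois_wt m i = i.+1%:R * pois_wt m i.+1.
Proof.
rewrite /pois_wt exprS factS natrM invfM.
have : (i.+1%:R : R) != 0 by rewrite pnatr_eq0.
have : (i`!%:R : R) != 0 by rewrite pnatr_eq0 -lt0n fact_gt0.
by move=> ? ?; field; apply/andP.
Qed.

Lemma pois_ltS m k : pois_lt m k.+1 = pois_lt m k + pois_wt m k.
Proof. by rewrite /pois_lt big_ord_recr. Qed.

Lemma pois_lt0 m : pois_lt m 0 = 0.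
Proof. by rewrite /pois_lt big_ord0. Qed.

Lemma pois_lt_0 k : pois_lt 0 k.+1 = 1.
Proof.
elim: k => [|k IH]; rewrite pois_ltS ?pois_lt0 ?IH /pois_wt oppr0 expR0 ?expr0.
  by rewrite add0r mul1r fact0 divr1.
by rewrite expr0n /= mulr0 mul0r addr0.
Qed.

Lemma pois_lt_ge0 m k : 0 <= m -> 0 <= pois_lt m k.
Proof. by move=> m0; apply: sumr_ge0 => i _; exact: pois_wt_ge0. Qed.

Lemma cvg_pois_lt m : pois_lt m k @[k --> \oo] --> (1 : R).
Proof.
have -> : (1 : R) = expR (- m) * expR m by rewrite -expRD addrC subrr expR0.
have -> : pois_lt m = (fun k => expR (- m) * series (exp_coeff m) k).
  apply/funext => k; rewrite /pois_lt /series/= big_mkord mulr_sumr.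
  by apply: eq_bigr => i _; rewrite /pois_wt /exp_coeff mulrA.
apply: cvgM; first exact: cvg_cst.
have -> : expR m = limn (series (exp_coeff m)) by [].
exact: is_cvg_series_exp_coeff.
Qed.

Lemma pois_lt_le1 m k : 0 <= m -> pois_lt m k <= 1.
Proof.
move=> m0; rewrite -(cvg_lim _ (@cvg_pois_lt m))//.
apply: nondecreasing_cvgn_le; last by apply/cvg_ex; exists 1; exact: cvg_pois_lt.
by apply/nondecreasing_seqP => n; rewrite pois_ltS lerDl pois_wt_ge0.
Qed.

Lemma is_derive_exprn (x : R) i :
  is_derive x 1 (fun y : R => y ^+ i) (i%:R * x ^+ i.-1).
Proof.
have h := is_deriveX i (is_derive_id x (1 : R)).
have -> : (fun y : R => y ^+ i) = (id : R -> R) ^+ i by rewrite exprfctE.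
by move: h; rewrite /GRing.scale/= mulr1.
Qed.

Lemma is_derive_pois_wt m i :
  is_derive m 1 (pois_wt ^~ i) ((if i is j.+1 then pois_wt m j else 0) - pois_wt m i).
Proof.
have dE : is_derive m 1 (fun x : R => expR (- x)) (- expR (- m)).
  have -> : (fun x : R => expR (- x)) = expR \o (-%R) by [].
  have dN : is_derive m 1 (-%R : R -> R) (-1) by exact: is_deriveNid.
  have := @is_derive1_comp R expR -%R m _ _ (is_derive_expR (- m)) dN.
  by rewrite mulrN1.
have dX : is_derive m 1 (fun x : R => x ^+ i / i`!%:R) (i%:R * m ^+ i.-1 / i`!%:R).
  have -> : (fun x : R => x ^+ i / i`!%:R) = (i`!%:R^-1 : R) \*: (fun x : R => x ^+ i).
    by apply/funext => x; rewrite /= mulrC.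
  have h := is_deriveZ (i`!%:R^-1 : R) (is_derive_exprn m i).
  by move: h; rewrite /GRing.scale/= mulrC.
have -> : (pois_wt ^~ i) = (fun x : R => expR (- x)) * (fun x : R => x ^+ i / i`!%:R).
  by apply/funext => x; rewrite /pois_wt/= -mulrA.
have := is_deriveM dE dX; move/is_derive_eq; apply; rewrite /GRing.scale/= /pois_wt.
case: i {dX} => [|i] /=.
  by rewrite fact0 !expr0; ring.
rewrite factS natrM invfM exprS.
have : (i.+1%:R : R) != 0 by rewrite pnatr_eq0.
have : (i`!%:R : R) != 0 by rewrite pnatr_eq0 -lt0n fact_gt0.
by move=> ? ?; field; apply/andP.
Qed.

(** The derivatives of the weights telescope, so that only the last weight survives. *)
Lemma is_derive_pois_lt m k : is_derive m 1 (pois_lt ^~ k.+1) (- pois_wt m k).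
Proof.
elim: k => [|k IH].
  have -> : pois_lt ^~ 1%N = pois_wt ^~ 0%N :> (R -> R).
    by apply/funext => x; rewrite pois_ltS pois_lt0 add0r.
  by have := is_derive_pois_wt m 0; rewrite sub0r.
have -> : pois_lt ^~ k.+2 = (pois_lt ^~ k.+1) + (pois_wt ^~ k.+1) :> (R -> R).
  by apply/funext => x; rewrite pois_ltS.
have := is_deriveD IH (is_derive_pois_wt m k.+1).
by move/is_derive_eq; apply; rewrite /=; ring.
Qed.

End poisson_calculus.

(** * Integrals and limits of Erlang tails *)

Section poisson_integrals.
Context {R : realType}.
Implicit Types (m t s : R) (i j k : nat).

Lemma is_derive_continuous (f F : R -> R) :
  (forall x : R, is_derive x 1 F (f x)) -> continuous F.
Proof.
by move=> dF x; apply: differentiable_continuous; apply/derivable1_diffP; exact: ex_derive.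
Qed.

Lemma is_derive_FTC (f F : R -> R) a b : a <= b ->
  (forall x : R, is_derive x 1 F (f x)) -> continuous f ->
  (\int[lebesgue_measure]_(x in `[a, b]) (f x)%:E = (F b - F a)%:E)%E.
Proof.
rewrite le_eqVlt => /predU1P[<-|ab] dF cf.
  by rewrite set_itv1 integral_set1 subrr.
have cF := is_derive_continuous dF.
rewrite (@continuous_FTC2 _ f F)//.
- exact: continuous_subspaceT.
- split; first by move=> x _; exact: ex_derive.
  + by apply: cvg_at_right_filter; exact: cF.
  + by apply: cvg_at_left_filter; exact: cF.
- by move=> x _; rewrite derive1E derive_val.
Qed.

Lemma is_derive_comp_affine (F f : R -> R) (a c : R) (x : R) :
  (forall y : R, is_derive y 1 F (f y)) ->
  is_derive x 1 (fun y => F (a * y + c)) (a * f (a * x + c)).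
Proof.
move=> dF.
have dA : is_derive x 1 (fun y : R => a * y + c) a.
  have := is_deriveD (is_deriveZ a (is_derive_id x (1 : R))) (is_derive_cst c x (1 : R)).
  by rewrite addr0 /GRing.scale/= mulr1.
have := @is_derive1_comp R F (fun y => a * y + c) x _ _ (dF _) dA.
by rewrite mulrC.
Qed.

Lemma continuous_pois_lt k : continuous (fun m : R => pois_lt m k).
Proof.
case: k => [|k]; last exact: is_derive_continuous (fun m => is_derive_pois_lt m k).
have -> : (fun m : R => pois_lt m 0) = cst 0 by apply/funext => m; rewrite pois_lt0.
exact: cst_continuous.
Qed.

Variable mu : R.
Hypothesis mu_gt0 : 0 < mu.

(* The mean of the minimum of t and an Erlang variable of shape k. *)
Definition mean_min k t : R := \sum_(i < k) (1 - pois_lt (mu * t) i.+1) / mu.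

(** Summand i is the mean time before t spent in stage i + 1, that is, 1/mu times the probability
    that this stage ends by t. Its derivative is [pois_wt (mu * t) i]. *)
Lemma is_derive_mean_min k (t : R) : is_derive t 1 (mean_min k) (pois_lt (mu * t) k).
Proof.
have -> : mean_min k = \sum_(i < k) (fun t : R => (1 - pois_lt (mu * t) i.+1) / mu).
  by apply/funext => x; rewrite fct_sumE.
rewrite {1}/pois_lt; apply: is_derive_sum => i.
have -> : (fun t : R => (1 - pois_lt (mu * t) i.+1) / mu) =
    mu^-1 \*: (cst 1 - (fun t => pois_lt (mu * t + 0) i.+1)) :> (R -> R).
  apply/funext => x; transitivity (mu^-1 * (1 - pois_lt (mu * x + 0) i.+1)) => //.
  by rewrite addr0 mulrC.
have h := @is_derive_comp_affine _ _ mu 0 t (fun y => is_derive_pois_lt y i).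
have := is_deriveZ mu^-1 (is_deriveB (is_derive_cst (1 : R) t (1 : R)) h).
move/is_derive_eq; apply.
by rewrite addr0 sub0r mulrN opprK /GRing.scale/= mulrA mulVf ?mul1r// gt_eqF.
Qed.

Lemma continuous_pois_ltM k : continuous (fun t : R => pois_lt (mu * t) k).
Proof.
move=> t; apply: (@continuous_comp _ _ _ (fun t : R => mu * t) (fun m : R => pois_lt m k)).
  exact: mulrl_continuous.
exact: continuous_pois_lt.
Qed.

Lemma mean_min0 k : mean_min k 0 = 0.
Proof.
by rewrite /mean_min big1// => i _; rewrite mulr0 pois_lt_0 subrr mul0r.
Qed.

Lemma integral_pois_lt k t : 0 <= t ->
  (\int[lebesgue_measure]_(s in `[0%R, t]) (pois_lt (mu * s) k)%:E
     = (mean_min k t)%:E)%E.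
Proof.
move=> t0; rewrite (is_derive_FTC t0 (is_derive_mean_min k) (@continuous_pois_ltM k)).
by rewrite mean_min0 subr0.
Qed.

Lemma mean_min_ge0 k t : 0 <= t -> 0 <= mean_min k t.
Proof.
move=> t0; apply: sumr_ge0 => i _; apply: divr_ge0; last exact: ltW.
by rewrite subr_ge0 pois_lt_le1 ?mulr_ge0// ltW.
Qed.

Lemma mean_min_le k t : 0 <= t -> mean_min k t <= t.
Proof.
move=> t0; rewrite -lee_fin -integral_pois_lt//.
apply: (@le_trans _ _ (\int[lebesgue_measure]_(s in `[0%R, t]) (cst 1 s))%E).
  apply: ge0_le_integral => //.
  - move=> x /=; rewrite in_itv/= => /andP[x0 _].
    by rewrite lee_fin pois_lt_ge0// mulr_ge0// ltW.
  - apply/measurable_EFinP; apply: measurable_funTS.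
    exact: continuous_measurable_fun (@continuous_pois_ltM k).
  - move=> x /=; rewrite in_itv/= => /andP[x0 _].
    by rewrite lee_fin pois_lt_le1// mulr_ge0// ltW.
by rewrite integral_cst//= mul1e lebesgue_measure_itv/= lte_fin; case: ifP => // _; rewrite ?oppr0 ?adde0 ?sube0// -EFinD subr0.
Qed.

(** The shape in which the terms of [f_] and [g_] are given. The induction step leaves exactly the
    recurrence [mul_pois_wt] divided by mu. *)
Lemma mean_minE k t :
  mean_min k t = t * pois_lt (mu * t) k + k%:R / mu * (1 - pois_lt (mu * t) k.+1).
Proof.
have mu0 : mu != 0 by rewrite gt_eqF.
rewrite /mean_min; elim: k => [|k IH]; first by rewrite big_ord0 pois_lt0; ring.
rewrite big_ord_recr/= IH !pois_ltS.
have /(congr1 (fun x => x / mu)) := mul_pois_wt (mu * t) k.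
rewrite -[mu * t * _]mulrA mulrAC mulfV// mul1r => e.
apply/eqP; rewrite -subr_eq0; apply/eqP.
transitivity (k.+1%:R * pois_wt (mu * t) k.+1 / mu - t * pois_wt (mu * t) k).
  by rewrite -natr1; field.
by rewrite e subrr.
Qed.

(** The integrand is the derivative of exp(-mu (s - v)) [pois_lt (mu * v) k.+1]: the product rule
    lowers k + 1 to k. The subtracted exponential is the value of this product at v = 0. *)
Lemma Erlang_integral k s : 0 <= s ->
  (\int[lebesgue_measure]_(v in `[0%R, s])
     (mu * expR (- (mu * (s - v))) * pois_lt (mu * v) k)%:E
   = (pois_lt (mu * s) k.+1 - expR (- (mu * s)))%:E)%E.
Proof.
move=> s0.
pose E (v : R) := expR (mu * v + - (mu * s)).
have EE v : expR (- (mu * (s - v))) = E v by rewrite /E; congr expR; ring.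
have dE (v : R) : is_derive v 1 E (mu * E v).
  exact: (@is_derive_comp_affine expR expR mu (- (mu * s)) v (@is_derive_expR R)).
have dF (v : R) : is_derive v 1 (E * (fun v => pois_lt (mu * v + 0) k.+1))
    (mu * expR (- (mu * (s - v))) * pois_lt (mu * v) k).
  have dP := @is_derive_comp_affine _ _ mu 0 v (fun y => is_derive_pois_lt y k).
  have := is_deriveM (dE v) dP; move/is_derive_eq; apply.
  by rewrite EE /GRing.scale/= addr0 pois_ltS; ring.
rewrite (is_derive_FTC s0 dF).
  congr EFin; transitivity
    (E s * pois_lt (mu * s + 0) k.+1 - E 0 * pois_lt (mu * 0 + 0) k.+1) => //.
  rewrite !addr0 !mulr0 pois_lt_0 /E subrr expR0 mulr0 add0r.
  by rewrite mul1r mulr1.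
move=> v; apply: cvgM; last exact: continuous_pois_ltM.
apply: cvgM; first exact: cvg_cst.
under eq_fun do rewrite EE.
by rewrite EE; exact: (is_derive_continuous dE).
Qed.

(** By [mul_pois_wt], and because a weight is at most 1, the weight at mu t is at most (i + 1)/(mu
    t). *)
Lemma cvgy_pois_wt i : pois_wt (mu * t) i @[t --> +oo] --> (0 : R).
Proof.
apply: (@squeeze_cvgr _ _ _ _ (cst 0) (fun t : R => (i.+1%:R / mu) * t^-1)).
- near=> t.
  have t0 : 0 < t by near: t; exact: nbhs_pinfty_gt.
  have mt0 : 0 < mu * t by rewrite mulr_gt0.
  rewrite pois_wt_ge0/=; last exact: ltW.
  have -> : i.+1%:R / mu * t^-1 = i.+1%:R / (mu * t) by rewrite -mulrA -invfM.
  rewrite ler_pdivlMr// mulrC mul_pois_wt.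
  rewrite -[leRHS]mulr1 ler_pM2l ?ltr0n//.
  apply: le_trans (pois_lt_le1 i.+2 (ltW mt0)).
  by rewrite pois_ltS lerDr pois_lt_ge0// ltW.
- exact: cvg_cst.
- rewrite -[X in _ --> X](mulr0 (i.+1%:R / mu)).
  apply: cvgM; first exact: cvg_cst.
  apply/(@gtr0_cvgV0 _ _ _ _ id); last exact: cvg_id.
  by apply: nbhs_pinfty_gt; exact: num_real.
Unshelve. all: by end_near. Qed.

Lemma cvgy_pois_lt k : pois_lt (mu * t) k @[t --> +oo] --> (0 : R).
Proof.
elim: k => [|k IH].
  have -> : (fun t => pois_lt (mu * t) 0) = cst 0 by apply/funext => t; rewrite pois_lt0.
  exact: cvg_cst.
have -> : (fun t => pois_lt (mu * t) k.+1) =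
    (fun t => pois_lt (mu * t) k + pois_wt (mu * t) k).
  by apply/funext => t; rewrite pois_ltS.
have h := cvgD IH (cvgy_pois_wt k).
by rewrite -[X in _ --> X](addr0 (0 : R)); exact: h.
Qed.

Lemma cvgy_mean_min k : mean_min k t @[t --> +oo] --> k%:R / mu.
Proof.
elim: k => [|k IH].
  have -> : mean_min 0 = cst 0 by apply/funext => t; rewrite /mean_min big_ord0.
  by rewrite mul0r; exact: cvg_cst.
have -> : mean_min k.+1 = (fun t => mean_min k t + (1 - pois_lt (mu * t) k.+1) / mu).
  by apply/funext => t; rewrite /mean_min big_ord_recr.
rewrite -natr1 mulrDl; apply: cvgD => //.
apply: cvgM; last exact: cvg_cst.
have h := cvgB (cvg_cst (1 : R)) (cvgy_pois_lt k.+1).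
by rewrite -[X in _ --> X](subr0 (1 : R)); exact: h.
Qed.

End poisson_integrals.

(** * Closed forms of the one-step costs and transition probabilities *)

Section formulas.
Context {R : realType}.
Implicit Types (m t : R) (i j k : nat).

Lemma pois_cdfE m k : 0 <= m -> pois_cdf m (k%:Z - 1) = pois_lt m k.
Proof.
(* At mean zero [poisson_prob] is a Dirac mass, so that case is separate. *)
rewrite le_eqVlt /pois_cdf /poisson_prob => /predU1P[<-|m0].
  rewrite ltxx diracE; case: k => [|k].
    by rewrite memNset /= ?pois_lt0// => -[].
  by rewrite pois_lt_0 mem_set//=; lia.
rewrite m0; have -> : [set i : nat | (i%:Z <= k%:Z - 1)%R] = `I_k.
  by apply/seteqP; split => i /=; lia.
rewrite esum_fset; last 2 first.
- exact: finite_II.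
- by move=> i _; rewrite lee_fin poisson_pmf_ge0.
rewrite -fsbig_ord sumEFin /=; apply: eq_bigr => i _.
by rewrite /poisson_pmf m0 /pois_wt mulrC mulrA.
Qed.

Variable mu : R.
Hypothesis mu_gt0 : 0 < mu.

Let mu_ge0 : 0 <= mu. Proof. exact: ltW. Qed.

Lemma f_E k t : 0 <= t -> f_ mu k t = t - mean_min mu k t.
Proof.
move=> t0; have mt0 : 0 <= mu * t by rewrite mulr_ge0.
rewrite /f_ mean_minE// pois_cdfE// (_ : k%:Z = k.+1%:Z - 1); last by lia.
by rewrite pois_cdfE//; ring.
Qed.

Lemma g_E k t : (0 < k)%N -> 0 <= t ->
  g_ mu k t = \sum_(1 <= j < k) mean_min mu j t.
Proof.
move=> k0 t0; have mt0 : 0 <= mu * t by rewrite mulr_ge0.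
have mu0 : mu != 0 by rewrite gt_eqF.
have gE j : g_ mu j.+1 t = j%:R * t * pois_lt (mu * t) j.+1
    - mu * t ^+ 2 / 2 * pois_lt (mu * t) j
    + j.+1%:R * j%:R / (2 * mu) * (1 - pois_lt (mu * t) j.+2).
  rewrite /g_ pois_cdfE// (_ : j.+1%:Z - 2 = j%:Z - 1); last by lia.
  rewrite pois_cdfE// (_ : j.+1%:Z = j.+2%:Z - 1); last by lia.
  by rewrite pois_cdfE// -natr1; ring.
case: k k0 => // k _; elim: k => [|k IH].
  by rewrite big_geq// gE pois_lt0; ring.
rewrite big_nat_recr//= -IH !gE mean_minE// !pois_ltS.
have e1 := mul_pois_wt (mu * t) k.
have e2 := mul_pois_wt (mu * t) k.+1.
apply/eqP; rewrite -subr_eq0; apply/eqP.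
(* With the closed forms inserted, the difference is a combination of the recurrence [mul_pois_wt]
   at k and at k + 1. *)
transitivity (k.+1%:R / (2 * mu) *
    (mu * t * pois_wt (mu * t) k.+1 - k.+2%:R * pois_wt (mu * t) k.+2)
  - t / 2 * (mu * t * pois_wt (mu * t) k - k.+1%:R * pois_wt (mu * t) k.+1)).
  by rewrite -[k.+2%:R]natr1 -[k.+1%:R]natr1; field.
by rewrite e1 e2 !subrr !mulr0 subrr.
Qed.

Lemma f_ge0 k t : 0 <= t -> 0 <= f_ mu k t.
Proof. by move=> t0; rewrite f_E// subr_ge0 mean_min_le. Qed.

Lemma g_ge0 k t : (0 < k)%N -> 0 <= t -> 0 <= g_ mu k t.
Proof.
by move=> k0 t0; rewrite g_E//; apply: sumr_ge0 => j _; rewrite mean_min_ge0.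
Qed.

Lemma sum_Erlang_means k : (0 < k)%N ->
  \sum_(1 <= j < k) (j%:R / mu) = k%:R * (k%:R - 1) / (2 * mu).
Proof.
have mu0 : mu != 0 by rewrite gt_eqF.
case: k => // k _; elim: k => [|k IH]; first by rewrite big_geq// subrr; ring.
by rewrite big_nat_recr//= IH -[k.+2%:R]natr1 -[k.+1%:R]natr1; field.
Qed.

Lemma cvgy_g k : (0 < k)%N ->
  g_ mu k t @[t --> +oo] --> k%:R * (k%:R - 1) / (2 * mu).
Proof.
move=> k0; apply: (@cvg_trans _ ((\sum_(1 <= j < k) mean_min mu j t) @[t --> +oo])).
  apply: near_eq_cvg; near=> t.
  have t0 : 0 <= t by near: t; apply: nbhs_pinfty_ge; exact: num_real.
  by rewrite g_E.
rewrite -sum_Erlang_means//; elim: k k0 => // k IH _.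
case: k IH => [_|k IH].
  have -> : (fun t => \sum_(1 <= j < 1) mean_min mu j t) = cst 0.
    by apply/funext => t; rewrite big_geq.
  by rewrite big_geq//; exact: cvg_cst.
have -> : (fun t => \sum_(1 <= j < k.+2) mean_min mu j t) =
   (fun t => \sum_(1 <= j < k.+1) mean_min mu j t + mean_min mu k.+1 t).
  by apply/funext => t; rewrite big_nat_recr.
rewrite big_nat_recr//=; apply: cvgD; first exact: IH.
exact: cvgy_mean_min.
Unshelve. all: by end_near. Qed.

Lemma p_1 k t : 0 <= t -> p_ mu k 1 t = 1 - pois_lt (mu * t) k.
Proof.
move=> t0; rewrite /p_ eqxx.
apply/cvg_lim => //.
apply: (@cvg_trans _ ((pois_lt (mu * t) n - pois_lt (mu * t) k) @[n --> \oo])).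
  apply: near_eq_cvg; near=> n.
  have kn : (k <= n)%N by near: n; exact: nbhs_infty_ge.
  have -> : pois_lt (mu * t) n =
      pois_lt (mu * t) k + \sum_(k <= i < n) pois_wt (mu * t) i.
    by rewrite /pois_lt -!(big_mkord xpredT (pois_wt _)) -big_cat_nat.
  by rewrite addrAC subrr add0r.
apply: cvgB; first exact: cvg_pois_lt.
exact: cvg_cst.
Unshelve. all: by end_near. Qed.

Lemma p_S k l t : p_ mu k l.+2 t = pois_wt (mu * t) (k.+1 - l.+2).
Proof. by rewrite /p_. Qed.

Lemma p_ge0 k l t : (0 < l)%N -> 0 <= t -> 0 <= p_ mu k l t.
Proof.
move=> l0 t0; have mt0 : 0 <= mu * t by rewrite mulr_ge0.
case: l l0 => // -[|l] _; first by rewrite p_1// subr_ge0 pois_lt_le1.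
by rewrite p_S pois_wt_ge0.
Qed.

Lemma p_gt0 k l t : (0 < l)%N -> 0 < t -> 0 < p_ mu k l t.
Proof.
move=> l0 t0; have mt0 : 0 < mu * t by rewrite mulr_gt0.
case: l l0 => // -[|l] _; last by rewrite p_S pois_wt_gt0.
rewrite p_1 ?ltW// subr_gt0 (@lt_le_trans _ _ (pois_lt (mu * t) k.+1))//.
  by rewrite pois_ltS ltrDl pois_wt_gt0.
by rewrite pois_lt_le1// ltW.
Qed.

(* With Erlang tails pois_lt, both sides are the probability that exactly
   k+1-l departures occur before time t. *)
Lemma p_tail k l t : (0 < l <= k.+1)%N -> 0 <= t ->
  p_ mu k l t = (if l == 1%N then 1 else pois_lt (mu * t) (k.+2 - l))
                - pois_lt (mu * t) (k.+1 - l).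
Proof.
move=> /andP[l0 lk] t0; case: l l0 lk => // -[_ _|l _ lk]; first by rewrite p_1//= subn1.
by rewrite p_S (@subSn l.+2 k.+1 lk) pois_ltS addrAC subrr add0r.
Qed.

End formulas.

(** * Exponential services *)

Section exponential_tail.
Context {R : realType}.
Variable mu : R.
Hypothesis mu_gt0 : 0 < mu.
Local Open Scope ereal_scope.

(** The maximum with 0 admits thresholds of any sign; [Erlang_step] uses the threshold s - Z. *)
Lemma exponential_prob_gt (a : R) :
  exponential_prob mu `]a, +oo[ = (expR (- (mu * Num.max a 0%R)))%:E.
Proof.
have nonneg : exponential_prob mu `[0%R, +oo[ = 1.
  rewrite -(integral_exponential_pdf mu_gt0) /exponential_prob.
  rewrite [RHS](integral_mkcond setT) [LHS]integral_mkcond; apply: eq_integral => x _.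
  rewrite !patchE in_setT; case: ifPn => //; rewrite notin_setE/= in_itv/= andbT.
  by move/negP; rewrite -ltNge => x0; rewrite lt0_exponential_pdf.
have [a0|a0] := ltP a 0%R.
  rewrite mulr0 oppr0 expR0.
  apply/eqP; rewrite eq_le; apply/andP; split.
    exact: (@probability_le1 _ _ _ (exponential_prob mu)).
  rewrite -[leLHS]nonneg; apply: (@le_measure _ _ _ (exponential_prob mu)); rewrite ?inE//.
  by move=> x /=; rewrite !in_itv/= !andbT; exact: lt_le_trans.
have c0 : exponential_prob mu `[0%R, a] = (1 - expR (- (mu * a)))%:E.
  move: a0; rewrite le_eqVlt => /predU1P[<-|a0].
    by rewrite mulr0 oppr0 expR0 subrr set_itv1 /exponential_prob integral_set1.
  by rewrite exponential_prob_itv0c// mulNr.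
have : exponential_prob mu (`[0%R, a] `|` `]a, +oo[) = 1.
  by rewrite -nonneg; congr exponential_prob; apply/esym/itv_bndbnd_setU; rewrite ?bnd_simp.
rewrite (measureU (exponential_prob mu))//; last first.
  rewrite -subset0 => x [] /=; rewrite !in_itv/= andbT => /andP[_].
  by rewrite leNgt => /negP.
rewrite [X in X + _]c0 => e.
have : exponential_prob mu `]a, +oo[ = 1 - (1 - expR (- (mu * a)))%:E.
  by rewrite -e addrAC subee// add0e.
by rewrite -EFinB => ->; congr EFin; ring.
Qed.

End exponential_tail.

(** * Exponential variables against thresholds known from the past *)

Section independent_tail.
Context {R : realType} {d : measure_display} {T : measurableType d}.
Variables (P : probability T R) (G : set (set T)) (Y : T -> R) (mu : R).
Hypothesis mu_gt0 : 0 < mu.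
Hypothesis G_sub : <<s G >> `<=` measurable.
Hypothesis mY : measurable_fun setT Y.
Hypothesis Y_exp : forall A : set R, measurable A -> P (Y @^-1` A) = exponential_prob mu A.
Hypothesis Y_indep : forall E A, <<s G >> E -> measurable A ->
  P (E `&` Y @^-1` A) = (P E * P (Y @^-1` A))%E.

Let TG : measurableType _ := g_sigma_algebraType G.

Lemma measurable_fun_sub (Z : T -> R) :
  measurable_fun (setT : set TG) (Z : TG -> R) -> measurable_fun setT Z.
Proof. by move=> mZ _ A mA; apply: G_sub; exact: mZ. Qed.

Local Open Scope ereal_scope.

(** Fubini for the product of the laws of (1_E, Z) and Y: given the past, the threshold Z is a
    constant. The indicator of E is made a coordinate, so that one independence statement covers
    both E and Z. *)
Lemma indep_gt (E : set T) (Z : T -> R) : <<s G >> E ->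
  measurable_fun (setT : set TG) (Z : TG -> R) ->
  P (E `&` [set x | Z x < Y x]%R) =
  \int[P]_(x in E) (expR (- (mu * Num.max (Z x) 0%R)))%:E.
Proof.
move=> GE mZG; have mE := G_sub GE; have mZ := measurable_fun_sub mZG.
pose W : T -> R * R := fun x => (\1_E x, Z x).
have mWG : measurable_fun (setT : set TG) (W : TG -> R * R).
  apply: measurable_fun_pair => //.
have mW : measurable_fun setT W.
  by apply: measurable_fun_pair => //; exact: measurable_indic.
pose WY := fun x => (W x, Y x).
have mWY : measurable_fun setT WY by exact: measurable_fun_pair.
pose U := [set z : (R * R) * R | (0 < z.1.1)%R /\ (z.1.2 < z.2)%R].
have mU : measurable U.
  have m1 : measurable_fun setT (fun z : (R * R) * R => z.1.1).
    exact: (measurableT_comp measurable_fst measurable_fst).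
  have m2 : measurable_fun setT (fun z : (R * R) * R => z.1.2).
    exact: (measurableT_comp measurable_snd measurable_fst).
  have m3 : measurable_fun setT (fun z : (R * R) * R => z.2) by exact: measurable_snd.
  rewrite /U; apply: measurableI.
    rewrite -[X in measurable X]setTI.
    exact: (measurable_fun_ltr (measurable_cst (0%R : R)) m1).
  rewrite -[X in measurable X]setTI.
  exact: (measurable_fun_ltr m2 m3).
pose mfW : {mfun T >-> (R * R)%type} := mfun_Sub (mem_set mW).
pose mfY : {mfun T >-> R} := mfun_Sub (mem_set mY).
pose mfWY : {mfun T >-> (R * R * R)%type} := mfun_Sub (mem_set mWY).
have h (A : set (R * R)) (A' : set R) : measurable A -> measurable A' ->
    distribution P mfWY (A `*` A') = distribution P mfW A * distribution P mfY A'.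
  move=> mA mA'; rewrite /distribution /pushforward -Y_indep//.
  by rewrite -[X in <<s G >> X]setTI; exact: mWG.
have e2 := product_measure_unique h mU.
have e1 : distribution P mfWY U = P (E `&` [set x | Z x < Y x]%R).
  rewrite /distribution /pushforward; congr (P _); apply/seteqP; split => x.
    change ((0 < \1_E x :> R)%R /\ (Z x < Y x)%R -> E x /\ (Z x < Y x)%R).
    by rewrite indicE ltr0n lt0b => -[/set_mem].
  change (E x /\ (Z x < Y x)%R -> (0 < \1_E x :> R)%R /\ (Z x < Y x)%R).
  by rewrite indicE ltr0n lt0b => -[/mem_set].
rewrite -e1; apply: (eq_trans (esym e2)).
rewrite /product_measure1 ge0_integral_distribution; last 2 first.
- exact: measurable_fun_xsection.
- by move=> w; exact: measure_ge0.
rewrite [RHS]integral_mkcond; apply: eq_integral => x _.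
rewrite patchE -(exponential_prob_gt mu_gt0) -Y_exp//=.
rewrite /distribution /pushforward /=.
case: ifPn => xE.
  congr (P _); apply/seteqP; split => y /=.
    by move=> /set_mem[_]; rewrite /= in_itv/= andbT.
  by rewrite in_itv/= andbT => zy; apply/mem_set; split => //=; rewrite indicE xE.
transitivity (P set0); last by rewrite measure0.
congr (P _).
rewrite -subset0 => y /set_mem[/=].
by rewrite indicE (negbTE xE) ltxx.
Qed.

(** The memoryless property for a random elapsed time Z known from the past: as Z and s are
    nonnegative, exp(-mu (Z + s)) factors under the integral of [indep_gt]. *)
Lemma indep_gt_shift (E : set T) (Z : T -> R) (s : R) : <<s G >> E ->
  measurable_fun (setT : set TG) (Z : TG -> R) ->
  (forall x, E x -> 0 <= Z x)%R -> (0 <= s)%R ->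
  P (E `&` [set x | Z x + s < Y x]%R) =
  (expR (- (mu * s)))%:E * P (E `&` [set x | Z x < Y x]%R).
Proof.
move=> GE mZ Z0 s0.
have mZs : measurable_fun (setT : set TG) ((fun x => Z x + s)%R : TG -> R).
  by apply: measurable_funD => //; exact: measurable_cst.
rewrite (indep_gt GE mZ) (indep_gt GE mZs) -ge0_integralZl_EFin; last 4 first.
- exact: G_sub.
- by move=> x _; rewrite lee_fin expR_ge0.
- apply/measurable_EFinP; apply: measurable_funTS.
  apply: measurableT_comp; first exact: measurable_expR.
  apply: measurableT_comp => //; apply: measurable_funM; first exact: measurable_cst.
  apply: measurable_maxr; last exact: measurable_cst.
  exact: measurable_fun_sub.
- exact: expR_ge0.
apply: eq_integral => x /set_mem Ex; rewrite -EFinM -expRD; congr (expR _)%:E.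
by rewrite !max_l ?addr_ge0 ?Z0//; ring.
Qed.

End independent_tail.

(** * Means computed from tails *)

Section layer_cake.
Context {R : realType} {d : measure_display} {T : measurableType d}.
Variables (P : probability T R) (E : set T) (V : T -> R).
Hypotheses (mE : measurable E) (mV : measurable_fun setT V).
Local Open Scope ereal_scope.

Lemma integral_truncated (w : R -> R) (s u : R) : continuous w ->
  \int[lebesgue_measure]_(v in `[0%R, s]) (w v * \1_`]-oo, u[ v)%:E =
  \int[lebesgue_measure]_(v in `[0%R, Num.min s u]) (w v)%:E.
Proof.
move=> cw; have mw : measurable_fun setT w by exact: continuous_measurable_fun.
transitivity (\int[lebesgue_measure]_(v in `[0%R, s] `&` `]-oo, u[) (w v)%:E).
  rewrite integral_mkcondr; apply: eq_integral => v _.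
  by rewrite patchE indicE; case: ifPn => _; rewrite ?mulr1// mulr0.
case: (ltP s u) => su.
  congr integral; apply/seteqP; split => v /=; rewrite !in_itv/=; first by case.
  by move=> /andP[v0 vs]; rewrite v0 vs (le_lt_trans vs).
(* The strict bound loses the endpoint u, which the integral does not see. *)
rewrite -integral_itv_bndo_bndc; last by apply/measurable_EFinP; exact: measurable_funTS.
congr integral; apply/seteqP; split => v /=; rewrite !in_itv/=.
  by case=> /andP[-> _].
by move=> /andP[v0 vu]; rewrite v0 vu (le_trans (ltW vu)).
Qed.

(** Tonelli on the region v < V x. The weight w = 1 yields the mean of min(s, V), and w v = mu
    exp(-mu (s - v)) the convolution with an exponential law. *)
Lemma layer_cake (w : R -> R) (s : R) : continuous w -> (forall v, 0 <= w v)%R ->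
  \int[P]_(x in E) \int[lebesgue_measure]_(v in `[0%R, Num.min s (V x)]) (w v)%:E =
  \int[lebesgue_measure]_(v in `[0%R, s]) ((w v)%:E * P (E `&` [set x | v < V x]%R)).
Proof.
move=> cw w0; have mw : measurable_fun setT w by exact: continuous_measurable_fun.
pose U := [set z : T * R | E z.1 /\ (z.2 < V z.1)%R].
have mV1 : measurable_fun setT (fun z : T * R => V z.1).
  exact: (measurableT_comp mV measurable_fst).
have mU : measurable U.
  apply: measurableI; first by rewrite -[X in measurable X]setTI; exact: measurable_fst.
  rewrite -[X in measurable X]setTI.
  exact: (measurable_fun_ltr measurable_snd mV1).
pose f (z : T * R) := (w z.2 * \1_`[0%R, s] z.2 * \1_U z)%:E.
have f0 z : 0 <= f z by rewrite lee_fin !mulr_ge0.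
have mf : measurable_fun setT f.
  apply/measurable_EFinP; apply: measurable_funM; last exact: measurable_indic.
  apply: measurable_funM; first exact: (measurableT_comp mw measurable_snd).
  apply: (measurableT_comp _ measurable_snd); exact: measurable_indic.
transitivity (\int[P]_x \int[lebesgue_measure]_v f (x, v)).
  rewrite integral_mkcond; apply: eq_integral => x _; rewrite patchE.
  case: ifPn => xE.
    rewrite -integral_truncated// integral_mkcond; apply: eq_integral => v _.
    rewrite patchE /f/=; case: ifPn => vs; rewrite !indicE.
      rewrite vs mulr1; congr (_ * _%:R)%:E; congr nat_of_bool.
      apply/idP/idP => /set_mem/= h; apply/mem_set => /=.
        by move: h; rewrite in_itv/= => h; split => //; exact: set_mem.
      by case: h => _; rewrite in_itv.
    by rewrite (negbTE vs) mulr0 mul0r.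
  rewrite integral0_eq// => v _; rewrite /f [X in (_ * X)%R]indicE memNset ?mulr0//=.
  by case=> Ex _; move: xE; rewrite notin_setE.
rewrite (fubini_tonelli (m1 := P) (m2 := lebesgue_measure) f mf f0).
rewrite [RHS]integral_mkcond; apply: eq_integral => v _.
rewrite patchE /f/=; case: ifPn => vs; last first.
  by rewrite indicE (negbTE vs) integral0_eq// => x _; rewrite mulr0 mul0r.
under eq_integral do rewrite [\1_`[0%R, s] v]indicE vs mulr1 EFinM.
rewrite ge0_integralZl_EFin//; last first.
  apply/measurable_EFinP.
  exact: (measurableT_comp (measurable_indic mU) (pair2_measurable v)).
congr (_ * _); have mEv : measurable (E `&` [set x | v < V x]%R).
  apply: measurableI => //; rewrite -[X in measurable X]setTI.
  exact: (measurable_fun_ltr (measurable_cst v) mV).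
by rewrite -[X in P X]setIT -integral_indic.
Qed.

Variables (mu : R) (k : nat).
Hypothesis mu_gt0 : (0 < mu)%R.
Hypothesis V_ge0 : forall x, E x -> (0 <= V x)%R.
Hypothesis V_Erlang : forall v, (0 <= v)%R ->
  P (E `&` [set x | v < V x]%R) = P E * (pois_lt (mu * v) k)%:E.

Let PE_fin : (fine (P E))%:E = P E.
Proof. by rewrite fineK// fin_num_measure. Qed.

Let PE_ge0 : (0 <= fine (P E))%R.
Proof. exact/fine_ge0/measure_ge0. Qed.

Lemma integral_min_Erlang (t : R) : (0 <= t)%R ->
  \int[P]_(x in E) (Num.min t (V x))%:E = P E * (mean_min mu k t)%:E.
Proof.
move=> t0; rewrite -integral_pois_lt// -PE_fin -ge0_integralZl_EFin//; last first.
- apply/measurable_EFinP; apply: measurable_funTS.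
  exact: continuous_measurable_fun (@continuous_pois_ltM _ _ k).
- by move=> v /=; rewrite in_itv/= => /andP[v0 _]; rewrite lee_fin pois_lt_ge0// mulr_ge0// ltW.
rewrite PE_fin; transitivity (\int[lebesgue_measure]_(v in `[0%R, t])
    (1%:E * P (E `&` [set x | v < V x]%R))).
  rewrite -(@layer_cake (cst 1%R))//; last exact: cst_continuous.
  apply: eq_integral => x /set_mem Ex.
  rewrite -[LHS]sube0 -EFinB (is_derive_FTC (f := cst 1%R) (F := id))//.
  - by rewrite le_min t0 V_ge0.
  - exact: cst_continuous.
apply: eq_integral => v /set_mem/=; rewrite in_itv/= => /andP[v0 _].
by rewrite mul1e V_Erlang.
Qed.

(** Monotone convergence along the truncations min(n, V): their integrals are [P E] times
    [mean_min mu k n], which tends to k/mu. *)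
Lemma integral_Erlang :
  \int[P]_(x in E) (V x)%:E = P E * (k%:R / mu)%:E.
Proof.
pose g (n : nat) x := (Num.min n%:R (V x))%:E.
have gV x : E x -> g n x @[n --> \oo] --> (V x)%:E.
  move=> Ex; apply: cvg_near_cst; near=> n.
  rewrite /g min_r//; near: n; exact: nbhs_infty_ger.
have := @cvg_monotone_convergence _ _ _ P E mE g.
have -> : \int[P]_(x in E) (fun x => limn (g^~ x)) x = \int[P]_(x in E) (V x)%:E.
  by apply: eq_integral => x /set_mem Ex; apply/cvg_lim => //; exact: gV.
move=> /(_ _ _ _)/cvg_lim <-//; last 3 first.
- move=> n; apply/measurable_EFinP; apply: measurable_funTS.
  by apply: measurable_minr => //; exact: measurable_cst.
- by move=> n x Ex; rewrite lee_fin le_min V_ge0// ler0n.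
- by move=> x Ex m n mn; rewrite lee_fin le_min ge_min ler_nat mn ge_min lexx orbT.
apply/cvg_lim => //.
under eq_fun do rewrite integral_min_Erlang// -PE_fin -EFinM.
rewrite -PE_fin -EFinM; apply: cvg_EFin; first exact: nearW.
apply: cvgM; first exact: cvg_cst.
apply: (@cvg_comp _ _ _ (fun n : nat => n%:R : R) (mean_min mu k) _ +oo%R).
  exact: cvgr_idn.
exact: cvgy_mean_min.
Unshelve. all: by end_near. Qed.

End layer_cake.

(** * Adding an independent exponential stage *)

Section Erlang_step.
Context {R : realType} {d : measure_display} {T : measurableType d}.
Variables (P : probability T R) (G : set (set T)) (Y : T -> R) (mu : R).
Hypothesis mu_gt0 : 0 < mu.
Hypothesis G_sub : <<s G >> `<=` measurable.
Hypothesis mY : measurable_fun setT Y.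
Hypothesis Y_exp : forall A : set R, measurable A -> P (Y @^-1` A) = exponential_prob mu A.
Hypothesis Y_indep : forall E A, <<s G >> E -> measurable A ->
  P (E `&` Y @^-1` A) = (P E * P (Y @^-1` A))%E.
Local Open Scope ereal_scope.

(* exp(-mu (s-u)^+) = exp(-mu s) + int_0^s mu exp(-mu (s-v)) 1_(v < u) dv for u >= 0,
   so the tail of Z + Y is an integral of the tail of Z. *)
Lemma Erlang_step (E : set T) (Z : T -> R) (k : nat) : <<s G >> E ->
  measurable_fun (setT : set (g_sigma_algebraType G)) (Z : g_sigma_algebraType G -> R) ->
  (forall x, E x -> 0 <= Z x)%R ->
  (forall v, (0 <= v)%R -> P (E `&` [set x | v < Z x]%R) = P E * (pois_lt (mu * v) k)%:E) ->
  forall s, (0 <= s)%R ->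
  P (E `&` [set x | s < Z x + Y x]%R) = P E * (pois_lt (mu * s) k.+1)%:E.
Proof.
move=> GE mZG Z0 tailZ s s0.
have mE := G_sub GE; have mZ := measurable_fun_sub G_sub mZG.
have msZ : measurable_fun (setT : set (g_sigma_algebraType G))
    ((fun x => s - Z x)%R : g_sigma_algebraType G -> R).
  by apply: measurable_funB => //; exact: measurable_cst.
have -> : [set x | s < Z x + Y x]%R = [set x | s - Z x < Y x]%R.
  by apply/seteqP; split => x /=; rewrite ltrBlDl.
rewrite (indep_gt mu_gt0 G_sub mY Y_exp Y_indep GE msZ).
pose w v := (mu * expR (- (mu * (s - v))))%R.
have dw (v : R) : is_derive v 1%R (fun v => expR (- (mu * (s - v))))%R (w v).
  have := @is_derive_comp_affine _ expR expR mu (- (mu * s)) v (@is_derive_expR R).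
  rewrite /w; have -> : (fun y => expR (mu * y + - (mu * s))) = (fun v => expR (- (mu * (s - v))))%R.
    by apply/funext => y; congr expR; ring.
  by move/is_derive_eq; apply; congr (_ * expR _)%R; ring.
have cw : continuous w.
  by move=> v; apply: cvgM; [exact: cvg_cst|exact: (is_derive_continuous dw)].
have w0 v : (0 <= w v)%R by rewrite mulr_ge0 ?expR_ge0// ltW.
pose F v := expR (- (mu * (s - v))).
have F0 : F 0%R = expR (- (mu * s)) by rewrite /F subr0.
have FE x : E x -> \int[lebesgue_measure]_(v in `[0%R, Num.min s (Z x)]) (w v)%:E =
    (F (Num.min s (Z x)) - F 0)%:E.
  by move=> Ex; rewrite (is_derive_FTC (F := F))// le_min s0 Z0.
transitivity (\int[P]_(x in E) ((F 0%R)%:E + (F (Num.min s (Z x)) - F 0)%:E)).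
  apply: eq_integral => x /set_mem Ex.
  rewrite -EFinD [(F 0 + _)%R]addrC subrK /F; congr (expR (- (mu * _)))%:E.
  by case: (leP s (Z x)) => sZ; [rewrite max_r ?subrr// subr_le0|rewrite max_l// subr_ge0 ltW].
rewrite ge0_integralD//; last 3 first.
- by move=> x _; rewrite lee_fin expR_ge0.
- by move=> x Ex; rewrite -FE//; apply: integral_ge0 => v _; rewrite lee_fin.
- apply/measurable_EFinP; apply: measurable_funTS; apply: measurable_funB => //.
  apply: (measurableT_comp (f := F)); last by apply: measurable_minr.
  exact: continuous_measurable_fun (is_derive_continuous dw).
have -> : \int[P]_(x in E) (F (Num.min s (Z x)) - F 0)%:E =
    \int[P]_(x in E) \int[lebesgue_measure]_(v in `[0%R, Num.min s (Z x)]) (w v)%:E.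
  by apply: eq_integral => x /set_mem Ex; rewrite FE.
rewrite F0 integral_cst// layer_cake//.
under eq_integral => v.
  rewrite inE/= in_itv/= => /andP[v0 _].
  rewrite tailZ// muleCA -EFinM; over.
have [r r0 PE] : exists2 r, (0 <= r)%R & P E = r%:E.
  by exists (fine (P E)); [exact/fine_ge0/measure_ge0|rewrite fineK// fin_num_measure].
rewrite PE.
rewrite ge0_integralZl_EFin//; last 2 first.
- move=> v /=; rewrite in_itv/= => /andP[v0 _].
  by rewrite lee_fin mulr_ge0// pois_lt_ge0// mulr_ge0// ltW.
- apply/measurable_EFinP; apply: measurable_funM.
    by apply: measurable_funTS; exact: continuous_measurable_fun.
  by apply: measurable_funTS; exact: continuous_measurable_fun (@continuous_pois_ltM _ _ k).
(* This integral falls short of the Erlang tail by [expR (- (mu * s))], which the constant term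
   restores. *)
rewrite Erlang_integral//.
rewrite [X in _ * X + _](_ : _ = r%:E)//.
by rewrite -!EFinM -EFinD; congr EFin; ring.
Qed.

End Erlang_step.

(** * Independence of the past *)

Section past.
Context {R : realType} {d : measure_display} {T : measurableType d}.
Variables (P : probability T R) (B : nat -> {RV P >-> R}).

(* <<s cyl c >> is the information carried by the service times of clients
   1, ..., c-1. *)
Definition cyl (c : nat) : set (set T) :=
  [set E | exists2 A : nat -> set R, (forall j, measurable (A j)) &
     E = \big[setI/setT]_(j <- iota 1 c.-1) (B j @^-1` A j)].

Lemma measurable_preimage_B j (A : set R) : measurable A -> measurable (B j @^-1` A).
Proof. by move=> mA; rewrite -[X in measurable X]setTI; exact: (measurable_funPT (B j)). Qed.

Lemma cyl_measurable c : cyl c `<=` measurable.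
Proof.
move=> _ [A mA ->]; apply: bigsetI_measurable => j _.
exact: measurable_preimage_B.
Qed.

Lemma past_measurable c : <<s cyl c >> `<=` measurable.
Proof.
by apply: smallest_sub; [exact: sigma_algebra_measurable|exact: cyl_measurable].
Qed.

Lemma cyl_setI_closed c : setI_closed (cyl c).
Proof.
move=> _ _ [A mA ->] [A' mA' ->]; exists (fun j => A j `&` A' j).
  by move=> j; exact: measurableI.
by rewrite -big_split/=; apply: eq_bigr.
Qed.

Lemma cyl_setT c : cyl c setT.
Proof. by exists (fun=> setT) => //; rewrite big1. Qed.

Lemma measurable_fun_past c j : (0 < j < c)%N ->
  measurable_fun (setT : set (g_sigma_algebraType (cyl c)))
    (B j : g_sigma_algebraType (cyl c) -> R).
Proof.
move=> /andP[j0 jc] _ A mA; rewrite setTI; apply: sub_sigma_algebra.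
exists (fun i => if i == j then A else setT).
  by move=> i; case: ifPn.
have jin : j \in iota 1 c.-1 by rewrite mem_iota; lia.
rewrite (bigD1_seq j)//= ?iota_uniq// eqxx big1 ?setIT// => i /negbTE ->.
exact: preimage_setT.
Qed.

Lemma past_mono c c' : (c <= c')%N -> <<s cyl c >> `<=` <<s cyl c' >>.
Proof.
move=> cc'; apply: smallest_sub; first exact: smallest_sigma_algebra.
move=> _ [A mA ->]; rewrite big_seq.
apply: (@bigsetI_measurable _ (g_sigma_algebraType (cyl c'))) => j.
rewrite mem_iota => jc; rewrite -[X in measurable X]setTI.
by apply: measurable_fun_past => //; lia.
Qed.

Variables (n : nat) (mu : R).
Hypothesis B_iid : iid_exponential B n mu.

Lemma service_exp c (A : set R) : (0 < c <= n)%N -> measurable A ->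
  P (B c @^-1` A) = exponential_prob mu A.
Proof. by move=> cn mA; apply: B_iid.1. Qed.

(** The independence hypothesis speaks of finite intersections. Both sides are finite measures in E
    that agree on the intersection-stable class of cylinders, hence on the sigma-algebra it
    generates. *)
Lemma past_indep c (E : set T) (A : set R) : (0 < c <= n)%N ->
  <<s cyl c >> E -> measurable A ->
  P (E `&` B c @^-1` A) = (P E * P (B c @^-1` A))%E.
Proof.
move=> cn cE mA; have mBA := measurable_preimage_B c mA.
have fin : P (B c @^-1` A) \is a fin_num by exact: fin_num_measure.
have r0 : 0 <= fine (P (B c @^-1` A)) by exact/fine_ge0/measure_ge0.
pose m1 := mrestr P mBA.
pose m2 := mscale (NngNum r0) P.
have m2E F : m2 F = (P F * P (B c @^-1` A))%E.
  by rewrite /m2 /mscale/= fineK// muleC.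
suff : m1 E = m2 E by rewrite m2E.
apply: (@g_sigma_algebra_measure_unique d R T (cyl c) (@cyl_measurable c) (fun=> setT)) => //.
- by move=> _; exact: cyl_setT.
- by rewrite bigcup_const//; exists 0%N.
- exact: cyl_setI_closed.
- move=> _ [A' mA' ->]; apply: (eq_trans _ (esym (m2E _))); rewrite /m1 /mrestr.
  (* The cylinder and the event on client c merge into one product over clients 1, ..., c. *)
  pose A'' j := if j == c then A else A' j.
  have mA'' j : measurable (A'' j) by rewrite /A''; case: ifPn.
  have e j : j \in iota 1 c.-1 -> A'' j = A' j.
    by rewrite mem_iota /A'' => jc; case: eqP => // jE; lia.
  have iotaE : iota 1 c = rcons (iota 1 c.-1) c.
    by have [k ->] : exists k, c = k.+1 by [exists c.-1; lia];
      rewrite -cats1 succnK -[[:: k.+1]]/(iota (1 + k) 1) -iotaD addn1.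
  have indep s : uniq s -> {subset s <= iota 1 n} ->
     P (\big[setI/setT]_(j <- s) (B j @^-1` A'' j)) = (\prod_(j <- s) P (B j @^-1` A'' j))%E.
    by move=> us sn; apply: B_iid.2 => // j /sn; rewrite mem_iota; lia.
  have := indep (iota 1 c) (iota_uniq _ _) _.
  have := indep (iota 1 c.-1) (iota_uniq _ _) _.
  have -> : \big[setI/setT]_(j <- iota 1 c.-1) (B j @^-1` A'' j) =
    \big[setI/setT]_(j <- iota 1 c.-1) (B j @^-1` A' j).
    by apply: eq_big_seq => j /e ->.
  have Ac : A'' c = A by rewrite /A'' eqxx.
  rewrite iotaE !big_rcons /= Ac.
  move=> h1 h2; rewrite h1; last by move=> j; rewrite !mem_iota; lia.
  have <- : \big[setI/setT]_(j <- iota 1 c.-1) (B j @^-1` A'' j) =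
    \big[setI/setT]_(j <- iota 1 c.-1) (B j @^-1` A' j).
    by apply: eq_big_seq => j /e ->.
  by apply: h2 => j; rewrite mem_rcons inE !mem_iota; lia.
- move=> _; rewrite /m1 /mrestr; rewrite ltey_eq fin_num_measure//.
Qed.

(** With a zero service time a client could leave at the instant of its arrival and escape the count
    in [queue_length]. *)
Definition positive_services : set T := [set x | forall j, (0 < j <= n)%N -> 0 < B j x].

Lemma positive_servicesE :
  positive_services = \big[setI/setT]_(j <- iota 1 n) (B j @^-1` `]0, +oo[).
Proof.
rewrite -bigcap_seq; apply/seteqP; split => x /= h j; rewrite /= ?mem_iota => jn.
  by rewrite in_itv/= andbT; apply: h; lia.
by have := h j; rewrite /= mem_iota in_itv/= andbT; apply; lia.
Qed.

Lemma measurable_positive_services : measurable positive_services.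
Proof.
rewrite positive_servicesE; apply: bigsetI_measurable => j _.
exact: measurable_preimage_B.
Qed.

Hypothesis mu_gt0 : 0 < mu.

Lemma probability_positive_services : P positive_services = 1%E.
Proof.
rewrite positive_servicesE B_iid.2 ?iota_uniq//; last by move=> j; rewrite mem_iota; lia.
rewrite big1_seq// => j /=; rewrite mem_iota => jn.
have jn' : (0 < j <= n)%N by lia.
rewrite service_exp//.
by rewrite exponential_prob_gt// max_l// mulr0 oppr0 expR0.
Qed.

Lemma probability_eq_positive (E E' : set T) : measurable E -> measurable E' ->
  E `&` positive_services = E' `&` positive_services -> P E = P E'.
Proof.
move=> mE mE' EE'.
have PI F : measurable F -> P F = P (F `&` positive_services).
  move=> mF; have mI := measurableI _ _ mF measurable_positive_services.
  apply/eqP; rewrite eq_le; apply/andP; split; last first.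
    by apply: le_measure; rewrite ?inE//; move=> x [].
  have mC := measurableC measurable_positive_services.
  have C0 : P (~` positive_services) = 0%E.
    by rewrite probability_setC ?probability_positive_services ?subee//; exact: measurable_positive_services.
  have FU : F `<=` (F `&` positive_services) `|` ~` positive_services.
    by move=> x Fx; have [?|?] := pselect (positive_services x); [left|right].
  apply: (@le_trans _ _ (P ((F `&` positive_services) `|` ~` positive_services))).
    by apply: le_measure; rewrite ?inE//; exact: measurableU.
  by apply: le_trans (measureU2 _ mI mC) _; rewrite [X in (_ + X)%E](_ : _ = 0%E) ?adde0.
by rewrite PI// EE' -PI.
Qed.

End past.

(** * Sample paths *)

Section sample_path.
Context {R : realType}.
Variables (tau : nat -> nat -> R) (b : nat -> R) (n : nat).
Hypothesis tau_ge0 : forall j k, 0 <= tau j k.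
Hypothesis b_gt0 : forall j, (0 < j <= n)%N -> 0 < b j.

Local Notation A := (arrival tau b).
Local Notation D := (departure tau b).
Local Notation Q := (queue_length tau b).

Lemma departure0 : D 0 = 0.
Proof. by []. Qed.

Lemma arrival_leS j : A j <= A j.+1.
Proof.
case: j => [|j]; first by rewrite arrival1.
by rewrite (arrivalS tau b (j := j.+1))// lerDl.
Qed.

Lemma arrival_le i j : (i <= j)%N -> A i <= A j.
Proof. by move=> ij; apply: (homo_leq (@lexx _ _) (@le_trans _ _) arrival_leS). Qed.

Lemma arrival_ge0 j : 0 <= A j.
Proof. by rewrite -[leLHS]/(A 0); exact: arrival_le. Qed.

Lemma departureS j : D j.+1 = Num.max (A j.+1) (D j) + b j.+1.
Proof. by rewrite departureE. Qed.

Lemma departure_ltS j : (j < n)%N -> D j < D j.+1.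
Proof.
move=> jn; rewrite departureS (@le_lt_trans _ _ (Num.max (A j.+1) (D j)))//.
  by rewrite le_max lexx orbT.
by rewrite ltrDl b_gt0.
Qed.

Lemma departure_lt i j : (i < j <= n)%N -> D i < D j.
Proof.
move=> /andP[ij jn]; elim: j ij jn => // j IH; rewrite ltnS leq_eqVlt => /predU1P[->|ij] jn.
  exact: departure_ltS.
by apply: lt_trans (departure_ltS jn); apply: IH => //; exact: ltnW.
Qed.

Lemma departure_le i j : (i <= j <= n)%N -> D i <= D j.
Proof.
move=> /andP[]; rewrite leq_eqVlt => /predU1P[->//|ij jn].
by apply/ltW/departure_lt; rewrite ij.
Qed.

Lemma arrival_lt_departure j : (0 < j <= n)%N -> A j < D j.
Proof.
case: j => // j jn; rewrite departureS (@le_lt_trans _ _ (Num.max (A j.+1) (D j)))//.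
  by rewrite le_max lexx.
by rewrite ltrDl b_gt0.
Qed.

(** c is the least index with s < D c; [departure 0 = 0] excludes c = 0 and stands in for the
    predecessor of client 1. *)
Lemma first_departure_after s j : 0 <= s -> s < D j ->
  exists2 c, (0 < c <= j)%N & D c.-1 <= s < D c.
Proof.
move=> s0 sD; have ex : exists c, s < D c by exists j.
case: (ex_minnP ex) => c sc cmin; have c0 : (0 < c)%N.
  by rewrite lt0n; apply/eqP => cE; move: sc; rewrite cE departure0 ltNge s0.
exists c; first by rewrite c0 cmin.
rewrite sc andbT leNgt; apply/negP => /cmin; lia.
Qed.

(** Departures are increasing, so the clients present form the block c, ..., j. *)
Lemma queue_lengthE j c : (0 < c <= j)%N -> (j <= n)%N ->
  D c.-1 <= A j < D c -> Q j = (j.+1 - c)%N.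
Proof.
move=> /andP[c0 cj] jn /andP[Dc Ac]; rewrite /queue_length.
have -> : iota 1 j = iota 1 c.-1 ++ iota c (j.+1 - c).
  by rewrite -{2}(prednK c0) -add1n -iotaD; congr iota; lia.
rewrite count_cat (_ : count _ (iota 1 c.-1) = 0%N) ?add0n.
  rewrite -[RHS](size_iota c); apply/eqP; rewrite -all_count; apply/allP => l.
  rewrite mem_iota => lc; apply: lt_le_trans Ac _; apply: departure_le; lia.
apply/eqP; rewrite -leqn0 leqNgt -has_count; apply/hasPn => l.
rewrite mem_iota => lc; rewrite -leNgt; apply: le_trans _ Dc.
by apply: departure_le; lia.
Qed.

Lemma queue_length_bounds j : (0 < j <= n)%N -> (0 < Q j <= j)%N.
Proof.
move=> jn; have [c cj Dc] := first_departure_after (arrival_ge0 j) (arrival_lt_departure jn).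
by rewrite (queue_lengthE cj _ Dc); lia.
Qed.

Lemma queue_lengthP j k : (0 < j <= n)%N -> (0 < k <= j)%N ->
  reflect (Q j = k) (D (j - k) <= A j < D (j - k).+1).
Proof.
move=> jn kj; apply: (iffP idP) => [h|<-].
  rewrite (@queue_lengthE _ (j - k).+1)//; lia.
have [c cj Dc] := first_departure_after (arrival_ge0 j) (arrival_lt_departure jn).
rewrite (queue_lengthE cj _ Dc); last by lia.
by rewrite (_ : j - (j.+1 - c) = c.-1)%N ?prednK//; lia.
Qed.

(* The residual time until the m-th departure, m = 1, ..., k, when k clients
   are present just after the arrival of client j. *)
Definition residual j k m : R := D (j - k + m) - A j.

#[local] Opaque arrival departure queue_length.

Section given_queue_length.
Variables j k : nat.
Hypotheses (jn : (0 < j <= n)%N) (kj : (0 < k <= j)%N) (Qjk : Q j = k).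

Lemma residual_gt0 m : (0 < m <= k)%N -> 0 < residual j k m.
Proof.
move=> mk; rewrite subr_gt0; have /andP[_ h] := introT (queue_lengthP jn kj) Qjk.
by apply: lt_le_trans h _; apply: departure_le; lia.
Qed.

(** Client j - k + m + 1 is already present at arrival j and its predecessor is not gone yet, so its
    service starts exactly at the departure of that predecessor. *)
Lemma residual_sum m : (0 < m < k)%N ->
  residual j k m.+1 = residual j k m + b (j - k + m).+1.
Proof.
move=> mk; have mk' : (0 < m <= k)%N by lia.
have := residual_gt0 mk'; rewrite subr_gt0 => h.
rewrite /residual addnS departureS max_r; first by rewrite addrAC.
by apply/ltW; apply: le_lt_trans h; apply: arrival_le; lia.
Qed.

Hypothesis jn' : (j < n)%N.

(** l clients are found exactly when k + 1 - l departures have occurred by the next arrival. The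
    lower bound is void when no departure is required (l = k + 1), the upper one when all k clients
    have left (l = 1): residual k + 1 would belong to the arriving client. *)
Lemma next_queue_lengthP l : (0 < l <= k.+1)%N ->
  reflect (Q j.+1 = l)
    (((l == k.+1) || (residual j k (k.+1 - l) <= tau j k)) &&
     ((l == 1%N) || (tau j k < residual j k (k.+2 - l)))).
Proof.
move=> lk; have AS : A j.+1 = A j + tau j k by rewrite arrivalS ?Qjk//; lia.
suff -> : ((l == k.+1) || (residual j k (k.+1 - l) <= tau j k)) &&
     ((l == 1%N) || (tau j k < residual j k (k.+2 - l))) =
    (D (j.+1 - l) <= A j.+1 < D (j.+1 - l).+1).
  by apply: queue_lengthP; lia.
rewrite AS /residual lerBlDl ltrBrDl.
have /andP[Dk _] := introT (queue_lengthP jn kj) Qjk.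
congr (_ && _).
  case: eqP => [->|lkN]/=; last by congr (D _ <= _); lia.
  by apply/esym/(le_trans Dk); rewrite lerDl.
case: eqP => [->|lkN]/=; last by congr (_ < D _); lia.
by rewrite subn1/= -AS; apply/esym/arrival_lt_departure; lia.
Qed.

Lemma next_queue_length_bounds : (0 < Q j.+1 <= k.+1)%N.
Proof.
have h : (0 < j.+1 <= n)%N by lia.
have /andP[Q0 Qj] := queue_length_bounds h; rewrite Q0/= leqNgt; apply/negP => kQ.
have Qb : (0 < Q j.+1 <= j.+1)%N by rewrite Q0.
have /andP[_ AD] := introT (queue_lengthP h Qb) erefl.
have /andP[DA _] := introT (queue_lengthP jn kj) Qjk.
have : A j < A j.
  apply: le_lt_trans (arrival_leS j) _; apply: lt_le_trans AD _.
  by apply: le_trans DA; apply: departure_le; lia.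
by rewrite ltxx.
Qed.

End given_queue_length.

(** * Idle and waiting times between consecutive arrivals *)

Lemma waitingE s l : (0 < l <= n)%N ->
  in_system tau b s l && ~~ in_service tau b s l = (A l <= s < D l.-1).
Proof.
move=> ln; rewrite /in_system /in_service /service_start ge_max ltNge.
have D1 : D l.-1 < D l by apply: departure_lt; lia.
rewrite [s < D l.-1]ltNge; case: (A l <= s) => //=.
case: (leP (D l.-1) s) => sD/=; first by rewrite andbN.
by rewrite andbT -ltNge (lt_trans sD).
Qed.

Lemma server_idleE i s : (0 < i < n)%N -> A i <= s < A i.+1 ->
  server_idle tau b n s = (D i <= s).
Proof.
move=> iN /andP[sA si]; apply/idP/idP => [/hasPn h|Di].
  rewrite leNgt; apply/negP => sD.
  have [c ci /andP[Dc sc]] := first_departure_after (le_trans (arrival_ge0 i) sA) sD.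
  have /h : c \in iota 1 n by rewrite mem_iota; lia.
  rewrite /in_service /service_start ge_max Dc sc !andbT => /negP; apply.
  by apply: le_trans sA; apply: arrival_le; lia.
apply/hasPn => l; rewrite mem_iota => ln; rewrite /in_service negb_and -leNgt -ltNge.
have [li|il] := leqP l i.
  by apply/orP; right; apply: le_trans Di; apply: departure_le; lia.
apply/orP; left; apply: lt_le_trans si _; rewrite /service_start le_max.
by rewrite arrival_le.
Qed.

Lemma itv_length (x y : R) :
  (if (x%:E < y%:E)%E then y%:E - x%:E else 0)%E = (Num.max (y - x) 0)%:E.
Proof.
rewrite lte_fin; case: ltP => xy; last by rewrite max_r// subr_le0.
by rewrite max_l ?EFinB// subr_ge0 ltW.
Qed.

Let idle_set i := [set s | A i <= s <= A n /\ server_idle tau b n s].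

Lemma idle_setS i : (0 < i < n)%N ->
  idle_set i = `[D i, A i.+1[ `|` idle_set i.+1.
Proof.
move=> iN; have AD : A i < D i by apply: arrival_lt_departure; lia.
have An : A i.+1 <= A n by apply: arrival_le; lia.
apply/seteqP; split => s; rewrite /idle_set/= in_itv/=.
  move=> [/andP[sA sn] idle]; case: (ltP s (A i.+1)) => si; last first.
    by right; split => //; rewrite si sn.
  by left; rewrite andbT -(server_idleE iN)// sA.
move=> [/andP[Ds si]|[/andP[si sn] idle]]; last first.
  by split => //; rewrite sn (le_trans (arrival_leS i)).
have sA : A i <= s by rewrite ltW// (lt_le_trans AD).
by rewrite sA ltW ?(lt_le_trans si)//; split => //; rewrite (server_idleE iN) ?sA.
Qed.

Lemma idle_set_last : idle_set n `<=` [set A n].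
Proof. by move=> s [/andP[? ?] _]; apply/eqP; rewrite eq_le; apply/andP. Qed.

Lemma measurable_idle_set_last : measurable (idle_set n).
Proof. by have [->|->] := subset_set1 idle_set_last. Qed.

Lemma measurable_idle_set i : (0 < i <= n)%N -> measurable (idle_set i).
Proof.
move=> iN; have [k kE] : exists k, k = (n - i)%N by exists (n - i)%N.
elim: k i kE iN => [|k IH] i kE iN.
  have -> : i = n by lia.
  exact: measurable_idle_set_last.
rewrite idle_setS; last by lia.
by apply: measurableU => //; apply: IH; lia.
Qed.

Lemma idle_time_last : idle_time tau b n n = 0%E.
Proof.
rewrite /idle_time -/(idle_set n).
have [->|->] := subset_set1 idle_set_last; first by rewrite measure0.
exact: lebesgue_measure_set1.
Qed.

Lemma idle_timeS i : (0 < i < n)%N ->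
  idle_time tau b n i = ((Num.max (A i.+1 - D i) 0)%:E + idle_time tau b n i.+1)%E.
Proof.
move=> iN; rewrite /idle_time -/(idle_set i) -/(idle_set i.+1) idle_setS//.
rewrite measureU//; last 2 first.
- by apply: measurable_idle_set; lia.
- rewrite -subset0 => s []; rewrite /idle_set/= in_itv/= => /andP[_ si] [/andP[+ _] _].
  by rewrite leNgt si.
congr (_ + _)%E; apply: (eq_trans (lebesgue_measure_itv _)); exact: itv_length.
Qed.

(** Integrating the number of waiting clients sums their waiting times: client l waits on [A l, D (l
    - 1)), cut off on the left at A i. *)
Lemma total_waitingE i :
  total_waiting tau b n i =
  (\sum_(1 <= l < n.+1) Num.max (D l.-1 - Num.max (A l) (A i)) 0)%:E.
Proof.
rewrite /total_waiting /nb_waiting.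
transitivity (\int[lebesgue_measure]_(s in `[A i, +oo[)
    (\sum_(l <- iota 1 n) (\1_(`[A l, D l.-1[%classic) s)%:E))%E.
  apply: eq_integral => s _; rewrite sumEFin; congr EFin.
  rewrite -sumn_count sumnE big_map natr_sum big_seq [RHS]big_seq.
  apply: eq_bigr => l; rewrite mem_iota => ln.
  rewrite waitingE; last by lia.
  by rewrite indicE mem_setE in_itv.
rewrite ge0_integral_sum//; last first.
  by move=> l; apply/measurable_EFinP; exact: measurable_indic.
rewrite /index_iota subn1 -sumEFin big_seq [RHS]big_seq; apply: eq_bigr => l ln.
rewrite integral_indic//.
have -> : `[A l, D l.-1[ `&` `[A i, +oo[ = `[Num.max (A l) (A i), D l.-1[%classic.
  apply/seteqP; split => s /=; rewrite !in_itv/= ge_max andbT.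
    by move=> [/andP[-> ->] ->].
  by move=> /andP[/andP[-> ->] ->].
apply: (eq_trans (lebesgue_measure_itv _)); exact: itv_length.
Qed.

Lemma subr_max_trunc (t y : R) : 0 <= t -> Num.max y 0 - Num.max (y - t) 0 = Num.min t (Num.max y 0).
Proof.
move=> t0; have [y0|y0] := leP y 0.
  have yt : y - t <= 0 by rewrite subr_le0 (le_trans y0).
  by rewrite (max_r yt) min_r// subr0.
have [ty|ty] := leP t y; first by rewrite max_l ?subr_ge0//; ring.
by rewrite max_r ?subr0// subr_le0 ltW.
Qed.

(** Clients 1, ..., i lose the part of their remaining wait that lies before A (i + 1); clients
    arriving later have no wait before it. *)
Lemma total_waitingS i : (0 < i < n)%N ->
  total_waiting tau b n i = ((\sum_(1 <= l < i.+1)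
      Num.min (A i.+1 - A i) (Num.max (D l.-1 - A i) 0))%:E
    + total_waiting tau b n i.+1)%E.
Proof.
move=> iN; rewrite !total_waitingE -EFinD; congr EFin.
rewrite (big_cat_nat (n := i.+1))//=; last by lia.
rewrite [in RHS](big_cat_nat (n := i.+1) (p := n.+1))//=; last by lia.
rewrite addrA; congr (_ + _).
  rewrite -big_split/= big_nat [RHS]big_nat; apply: eq_bigr => l li.
  have Al : A l <= A i by apply: arrival_le; lia.
  rewrite (max_r Al) (max_r (le_trans Al (arrival_leS i))).
  rewrite -subr_max_trunc ?subr_ge0 ?arrival_leS//.
  by rewrite opprB addrA subrK subrK.
rewrite big_nat [RHS]big_nat; apply: eq_bigr => l li.
have Al : A i.+1 <= A l by apply: arrival_le; lia.
by rewrite (max_l Al) (max_l (le_trans (arrival_leS i) Al)).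
Qed.

Section given_queue_length_cost.
Variables (om : R) (j k : nat).
Hypotheses (jn : (0 < j <= n)%N) (kj : (0 < k <= j)%N) (Qjk : Q j = k).

(** Clients up to j - k + 1 no longer wait and contribute F 0 = 0. Each later client l waits for its
    predecessor, whose departure is number m = l - 1 - (j - k); hence m stops at k - 1. *)
Lemma sum_residual (F : R -> R) : F 0 = 0 ->
  \sum_(1 <= l < j.+1) F (Num.max (D l.-1 - A j) 0) =
  \sum_(1 <= m < k) F (residual j k m).
Proof.
move=> F0; have /andP[DA _] := introT (queue_lengthP jn kj) Qjk.
rewrite (big_cat_nat (n := (j - k).+2))//=; last by lia.
rewrite big_nat big1 ?add0r; last first.
  move=> l lj; rewrite max_r// subr_le0; apply: le_trans DA; apply: departure_le; lia.
rewrite -{1}[(j - k).+2]add1n big_addn.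
rewrite (_ : (j.+1 - (j - k).+1)%N = k); last by lia.
rewrite big_nat [RHS]big_nat; apply: eq_bigr => m mk.
rewrite addnS/= addnC max_l//.
by apply/ltW/residual_gt0 => //; lia.
Qed.

End given_queue_length_cost.

Lemma cost_last (om : R) k : (0 < k <= n)%N -> Q n = k ->
  cost tau b om n n = ((1 - om) * \sum_(1 <= m < k) residual n k m)%:E.
Proof.
move=> kn Qnk; have nn : (0 < n <= n)%N by lia.
rewrite /cost idle_time_last mule0 add0e total_waitingE -EFinM.
rewrite -(sum_residual nn kn Qnk (F := id))//; congr (_ * _)%:E.
rewrite big_nat [RHS]big_nat; apply: eq_bigr => l ln.
by rewrite (max_r (x := A l))//; apply: arrival_le; lia.
Qed.

Lemma cost_step (om : R) j k : 0 <= om <= 1 -> (0 < j < n)%N -> (0 < k <= j)%N -> Q j = k ->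
  cost tau b om n j =
  ((om * (tau j k - Num.min (tau j k) (residual j k k)) +
    (1 - om) * \sum_(1 <= m < k) Num.min (tau j k) (residual j k m))%:E
   + cost tau b om n j.+1)%E.
Proof.
move=> /andP[om0 om1] jn kj Qjk; have jn' : (0 < j <= n)%N by lia.
have AS : A j.+1 - A j = tau j k by rewrite arrivalS ?Qjk; [rewrite addrC addKr|lia].
rewrite /cost idle_timeS// total_waitingS//.
have idle0 : (0 <= idle_time tau b n j.+1)%E by exact: measure_ge0.
have wait0 : (0 <= total_waiting tau b n j.+1)%E.
  by apply: integral_ge0 => s _; rewrite lee_fin.
rewrite ge0_muleDr//; last by rewrite lee_fin le_max lexx orbT.
rewrite ge0_muleDr//; last first.
  rewrite lee_fin; apply: sumr_ge0 => l _; rewrite le_min le_max lexx orbT andbT.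
  by rewrite subr_ge0 arrival_leS.
rewrite addeACA -!EFinM -EFinD; congr (_%:E + _)%E; congr (_ * _ + _ * _).
  rewrite -AS /residual subnK; last by lia.
  have [AD|AD] := leP (A j.+1 - A j) (D j - A j).
    by rewrite max_r; [ring|rewrite subr_le0 -(lerD2r (- A j))].
  by rewrite max_l; [ring|rewrite subr_ge0 -(lerD2r (- A j)) ltW].
rewrite AS (sum_residual jn' kj Qjk (F := fun y => Num.min (tau j k) y))//.
by rewrite min_r.
Qed.

End sample_path.

(** * Measurability *)

Section queue_measurability.
Context {R : realType} {d : measure_display} {T : measurableType d}.
Variables (tau : nat -> nat -> R) (b : nat -> T -> R).
Hypothesis mb : forall j, measurable_fun setT (b j).

Lemma measurable_count (s : seq nat) (p : nat -> T -> bool) :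
  (forall l, measurable_fun setT (p l)) ->
  measurable_fun setT (fun x => (count (p^~ x) s)%:R : R).
Proof.
move=> mp; have -> : (fun x => (count (p^~ x) s)%:R : R) =
    (fun x => \sum_(l <- s) (if p l x then 1 else 0)).
  apply/funext => x; rewrite -sumn_count sumnE big_map natr_sum.
  by apply: eq_bigr => l _; case: (p l x).
by apply: measurable_sum => l; apply: measurable_fun_ifT.
Qed.

Lemma measurable_has (s : seq nat) (p : nat -> T -> bool) :
  (forall l, measurable_fun setT (p l)) ->
  measurable_fun setT (fun x => has (p^~ x) s).
Proof.
by move=> mp; elim: s => [|l s IH] /=; [exact: measurable_cst|exact: measurable_or].
Qed.

(** The induction carries all departures up to j, because the next arrival time depends on them
    through the queue length. *)
Lemma measurable_arrival_departure j :
  measurable_fun setT (fun x => arrival tau (b^~ x) j) /\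
  (forall l, (l <= j)%N -> measurable_fun setT (fun x => departure tau (b^~ x) l)).
Proof.
elim: j => [|j [mA mD]].
  split; first exact: (@measurable_cst _ _ _ _ _ (0 : R)).
  by move=> l; rewrite leqn0 => /eqP ->; exact: (@measurable_cst _ _ _ _ _ (0 : R)).
have mA' : measurable_fun setT (fun x => arrival tau (b^~ x) j.+1).
  case: (posnP j) => [->|j0]; first exact: (@measurable_cst _ _ _ _ _ (0 : R)).
  (* The queue length takes finitely many values and [tau j] is constant on each, so the gap is a
     finite sum of measurable pieces. *)
  have -> : (fun x => arrival tau (b^~ x) j.+1) = (fun x => arrival tau (b^~ x) j +
      \sum_(k < j.+1) (if queue_length tau (b^~ x) j == k then tau j k else 0)).
    apply/funext => x; rewrite arrivalS//; congr (_ + _).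
    have Qj : (queue_length tau (b^~ x) j < j.+1)%N.
      by rewrite ltnS (leq_trans (count_size _ _))// size_iota.
    rewrite -big_mkcond (big_pred1 (Ordinal Qj))//.
  apply: measurable_funD => //; apply: measurable_sum => k.
  apply: measurable_fun_ifT => //.
  have -> : (fun x => queue_length tau (b^~ x) j == k) =
      (fun x => (queue_length tau (b^~ x) j)%:R == k%:R :> R).
    by apply/funext => x; rewrite eqr_nat.
  have -> : (fun x => (queue_length tau (b^~ x) j)%:R == k%:R :> R) = (fun x =>
      ((queue_length tau (b^~ x) j)%:R <= k%:R :> R) && (k%:R <= (queue_length tau (b^~ x) j)%:R :> R)).
    by apply/funext => x; rewrite eq_le.
  have mQ : measurable_fun setT (fun x => (queue_length tau (b^~ x) j)%:R : R).
    rewrite /queue_length.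
    (* [measurable_count] asks for every index l, while only departures up to j are covered by the
       induction; the guard [l <= j] makes the others trivial. *)
    have -> : (fun x => (count (fun l => arrival tau (b^~ x) j < departure tau (b^~ x) l) (iota 1 j))%:R : R) =
      (fun x => (count (fun l => (l <= j)%N && (arrival tau (b^~ x) j < departure tau (b^~ x) l)) (iota 1 j))%:R).
      apply/funext => x; congr (_%:R); apply: eq_in_count => l.
      by rewrite mem_iota => lj; rewrite (_ : (l <= j)%N)//; lia.
    apply: (@measurable_count _ (fun l x =>
      (l <= j)%N && (arrival tau (b^~ x) j < departure tau (b^~ x) l))) => l.
    case: (leqP l j) => lj /=; last exact: measurable_cst.
    by apply: measurable_fun_ltr => //; exact: mD.
  by apply: measurable_and; apply: measurable_fun_ler => //; exact: measurable_cst.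
split => // l; rewrite leq_eqVlt ltnS => /predU1P[->|]; last exact: mD.
have -> : (fun x => departure tau (b^~ x) j.+1) =
   (fun x => Num.max (arrival tau (b^~ x) j.+1) (departure tau (b^~ x) j) + b j.+1 x).
  by apply/funext => x; rewrite departureS.
by apply: measurable_funD => //; apply: measurable_maxr => //; exact: mD.
Qed.

Lemma measurable_arrival j : measurable_fun setT (fun x => arrival tau (b^~ x) j).
Proof. exact: (measurable_arrival_departure j).1. Qed.

Lemma measurable_departure j : measurable_fun setT (fun x => departure tau (b^~ x) j).
Proof. exact: (measurable_arrival_departure j).2. Qed.

Lemma measurable_queue_length j k : measurable [set x | queue_length tau (b^~ x) j = k].
Proof.
have mQ : measurable_fun setT (fun x => (queue_length tau (b^~ x) j)%:R : R).
  apply: (@measurable_count _ (fun l x => arrival tau (b^~ x) j < departure tau (b^~ x) l)) => l.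
  apply: measurable_fun_ltr; [exact: measurable_arrival|exact: measurable_departure].
have -> : [set x | queue_length tau (b^~ x) j = k] =
    (fun x => (queue_length tau (b^~ x) j)%:R : R) @^-1` [set k%:R].
  by apply/seteqP; split => x /= => [->//|/eqP]; rewrite eqr_nat => /eqP.
by rewrite -[X in measurable X]setTI; exact: mQ.
Qed.

Lemma measurable_residual j k m : measurable_fun setT (fun x => residual tau (b^~ x) j k m).
Proof. by apply: measurable_funB; [exact: measurable_departure|exact: measurable_arrival]. Qed.

End queue_measurability.

(** * Measurability of the cost *)

Section cost_measurability.
Context {R : realType} {d : measure_display} {T : measurableType d}.
Variables (tau : nat -> nat -> R) (b : nat -> T -> R).
Hypothesis mb : forall j, measurable_fun setT (b j).

(* Functions of a scenario x and a time s are measurable on the product space, so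
   that the integrals over time are measurable in x by Fubini's theorem. *)
Let A l (z : T * R) : R := arrival tau (b^~ z.1) l.
Let D l (z : T * R) : R := departure tau (b^~ z.1) l.

Let mA l : measurable_fun setT (A l).
Proof. exact: (measurableT_comp (measurable_arrival tau mb l) measurable_fst). Qed.

Let mD l : measurable_fun setT (D l).
Proof. exact: (measurableT_comp (measurable_departure tau mb l) measurable_fst). Qed.

Let ms : measurable_fun setT (fun z : T * R => z.2).
Proof. exact: measurable_snd. Qed.

Let m_in_system l : measurable_fun setT (fun z : T * R => in_system tau (b^~ z.1) z.2 l).
Proof.
apply: measurable_and; first exact: (measurable_fun_ler (mA l) ms).
exact: (measurable_fun_ltr ms (mD l)).
Qed.

Let m_in_service l : measurable_fun setT (fun z : T * R => in_service tau (b^~ z.1) z.2 l).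
Proof.
apply: measurable_and; last exact: (measurable_fun_ltr ms (mD l)).
exact: (measurable_fun_ler (measurable_maxr (mA l) (mD l.-1)) ms).
Qed.

Lemma measurable_total_waiting n i :
  measurable_fun setT (fun x => total_waiting tau (b^~ x) n i).
Proof.
pose f (z : T * R) : \bar R :=
  ((nb_waiting tau (b^~ z.1) n z.2)%:R * (if A i z <= z.2 then 1 else 0))%:E.
have f0 z : (0 <= f z)%E by rewrite lee_fin mulr_ge0//; case: ifP.
have mf : measurable_fun setT f.
  apply/measurable_EFinP; apply: measurable_funM.
    apply: (@measurable_count R _ _ _ (fun l (z : T * R) =>
      in_system tau (b^~ z.1) z.2 l && ~~ in_service tau (b^~ z.1) z.2 l)) => l.
    by apply: measurable_and => //; exact: measurable_neg.
  by apply: measurable_fun_ifT => //; exact: (measurable_fun_ler (mA i) ms).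
have := measurable_fun_fubini_tonelli_F (m2 := lebesgue_measure) f mf f0.
congr measurable_fun; apply/funext => x.
rewrite /fubini_F /total_waiting [RHS]integral_mkcond; apply: eq_integral => s _.
by rewrite patchE mem_setE in_itv/= andbT /f/= /A/=; case: ifP; rewrite ?mulr1// mulr0.
Qed.

Lemma measurable_idle_time n i :
  measurable_fun setT (fun x => idle_time tau (b^~ x) n i).
Proof.
pose U := [set z : T * R | (A i z <= z.2) && (z.2 <= A n z) && server_idle tau (b^~ z.1) n z.2].
have mU : measurable U.
  rewrite -[X in measurable X]setTI.
  suff : measurable_fun setT (fun z : T * R => (A i z <= z.2) && (z.2 <= A n z) && server_idle tau (b^~ z.1) n z.2).
    by move=> h; exact: (h measurableT [set true]).
  apply: measurable_and; first by apply: measurable_and; apply: measurable_fun_ler.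
  apply: measurable_neg.
  exact: (@measurable_has _ _ _ (fun l (z : T * R) => in_service tau (b^~ z.1) z.2 l)).
have := measurable_fun_xsection lebesgue_measure mU.
congr measurable_fun; apply/funext => x; rewrite /idle_time/=; congr lebesgue_measure.
apply/seteqP; split => s; rewrite /xsection/= inE /U/=.
  by move=> /andP[].
by move=> [-> ->].
Qed.

Lemma measurable_cost om n i : measurable_fun setT (fun x => cost tau (b^~ x) om n i).
Proof.
by apply: emeasurable_funD; apply: measurable_funeM;
  [exact: measurable_idle_time|exact: measurable_total_waiting].
Qed.

Lemma cost_ge0 om n i (x : T) : 0 <= om <= 1 -> (0 <= cost tau (b^~ x) om n i)%E.
Proof.
move=> /andP[om0 om1]; apply: adde_ge0; apply: mule_ge0; rewrite ?lee_fin ?subr_ge0//.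
by apply: integral_ge0 => s _; rewrite lee_fin.
Qed.

End cost_measurability.

(** * The Markov property *)

Section markov.
Context {R : realType} {d : measure_display} {T : measurableType d}.
Variables (P : probability T R) (B : nat -> {RV P >-> R}) (n : nat).
Variable tau : nat -> nat -> R.
Hypothesis tau_ge0 : policy tau.

Local Notation past c := (g_sigma_algebraType (cyl B c)).
Local Notation Omega := (positive_services B n).
Local Notation Q j x := (queue_length tau (fun i => B i x) j).
Local Notation res j k m x := (residual tau (fun i => B i x) j k m).

Lemma measurable_fun_past_mono c c' (X : T -> R) : (c <= c')%N ->
  measurable_fun (setT : set (past c)) (X : past c -> R) ->
  measurable_fun (setT : set (past c')) (X : past c' -> R).
Proof. move=> cc' mX _ A mA. exact: (past_mono cc' (mX measurableT A mA)). Qed.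

Lemma past_lt c (X Y : T -> R) :
  measurable_fun (setT : set (past c)) (X : past c -> R) ->
  measurable_fun (setT : set (past c)) (Y : past c -> R) ->
  <<s cyl B c >> [set x | X x < Y x].
Proof.
move=> mX mY; rewrite -[X in <<s _ >> X]setTI.
exact: (measurable_fun_ltr mX mY measurableT (Y := [set true])).
Qed.

Lemma past_le c (X Y : T -> R) :
  measurable_fun (setT : set (past c)) (X : past c -> R) ->
  measurable_fun (setT : set (past c)) (Y : past c -> R) ->
  <<s cyl B c >> [set x | X x <= Y x].
Proof.
move=> mX mY; rewrite -[X in <<s _ >> X]setTI.
exact: (measurable_fun_ler mX mY measurableT (Y := [set true])).
Qed.

Lemma past_setI c (E F : set T) :
  <<s cyl B c >> E -> <<s cyl B c >> F -> <<s cyl B c >> (E `&` F).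
Proof. exact: (@measurableI _ (past c)). Qed.

Lemma past_cst c (a : R) : measurable_fun (setT : set (past c)) (cst a : past c -> R).
Proof. exact: measurable_cst. Qed.

(* H is an event concerning the system up to the arrival of client j at which k
   clients are present. The client in service is c = j - k + 1; X is the time
   already spent in service, and beyond {X < B c} the event H only depends on
   the services completed before. *)
Definition renewal (j k : nat) (H : set T) : Prop :=
  [/\ (0 < k <= j)%N /\ (j <= n)%N, measurable H &
   exists E X, let c := (j - k).+1 in
   [/\ <<s cyl B c >> E, measurable_fun (setT : set (past c)) (X : past c -> R),
       forall x, E x -> 0 <= X x,
       H `&` Omega = E `&` [set x | X x < B c x] `&` Omega &
       forall x, (H `&` Omega) x -> Q j x = k /\ res j k 1 x = B c x - X x]].

Lemma renewal_first : (0 < n)%N -> renewal 1 1 setT.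
Proof.
move=> n0; split => //; exists setT, (fun=> 0); split => //.
- exact: (@measurableT _ (past (1 - 1).+1)).
- by apply/seteqP; split => x // [_ Ox]; split => //; split => //; apply: Ox; lia.
- move=> x [_ Ox]; have b0 : forall i, (0 < i <= n)%N -> 0 < B i x by [].
  have n1 : (0 < 1 <= n)%N by lia.
  have := queue_length_bounds tau_ge0 b0 n1; split; first by lia.
  by rewrite /residual departureS arrival1 max_l// subr0 add0r subr0.
Qed.

Variable mu : R.
Hypothesis mu_gt0 : 0 < mu.
Hypothesis B_iid : iid_exponential B n mu.

(** Replaces the residual, which involves random arrival times, by a Z measurable in the services of
    clients up to j - k + m, so that the next service is independent of it. The first stage uses the
    lack of memory of the service in progress; every further stage adds a complete service by
    [Erlang_step]. *)
Lemma renewal_stage j k H m : renewal j k H -> (0 < m <= k)%N ->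
  exists E Z, let c := (j - k + m).+1 in
  [/\ <<s cyl B c >> E, measurable_fun (setT : set (past c)) (Z : past c -> R),
      forall x, E x -> 0 <= Z x,
      H `&` Omega = E `&` Omega &
      (forall x, (H `&` Omega) x -> res j k m x = Z x) /\
      (forall v, 0 <= v ->
         P (E `&` [set x | v < Z x]) = (P E * (pois_lt (mu * v) m)%:E)%E)].
Proof.
move=> [[kj jn] mH [E [X [cE mX X0 HE HX]]]]; set c := (j - k).+1 in cE mX HE HX.
have cn : (0 < c <= n)%N by rewrite /c; lia.
elim: m => [|m IH] mk; first by lia.
case: (posnP m) => [m0|m0].
  subst m; rewrite addn1 -/c.
  have mX' : measurable_fun (setT : set (past c.+1)) (X : past c.+1 -> R).
    exact: measurable_fun_past_mono mX.
  have mB : measurable_fun (setT : set (past c.+1)) (B c : past c.+1 -> R).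
    by apply: measurable_fun_past; lia.
  exists (E `&` [set x | X x < B c x]), (fun x => B c x - X x); split.
  - apply: past_setI; first exact: (past_mono (leqnSn c)).
    exact: past_lt.
  - exact: measurable_funB.
  - by move=> x [_ /=]; rewrite subr_ge0 => /ltW.
  - exact: HE.
  - split; first by move=> x /HX[].
    move=> v v0.
    have -> : E `&` [set x | X x < B c x] `&` [set x | v < B c x - X x] =
        E `&` [set x | X x + v < B c x].
      apply/seteqP; split => x /=; rewrite ltrBrDl addrC; first by case=> -[].
      move=> [Ex h]; split => //; split => //; apply: le_lt_trans h.
      by rewrite lerDr.
    rewrite (indep_gt_shift mu_gt0 (@past_measurable _ _ _ P B c) _
      (fun A => service_exp B_iid cn (A := A))
      (fun E A => past_indep B_iid cn (E := E) (A := A)) cE mX X0 v0)//.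
    by rewrite muleC pois_ltS pois_lt0 add0r /pois_wt expr0 fact0 mulr1 divr1.
have mk' : (0 < m <= k)%N by lia.
have [F [Z [cF mZ Z0 HF [HZ tailZ]]]] := IH mk'; set c' := (j - k + m).+1 in cF mZ.
have cn' : (0 < c' <= n)%N by rewrite /c'; lia.
rewrite addnS -/c'.
have mZ' : measurable_fun (setT : set (past c'.+1)) (Z : past c'.+1 -> R).
  exact: measurable_fun_past_mono mZ.
have mB : measurable_fun (setT : set (past c'.+1)) (B c' : past c'.+1 -> R).
  by apply: measurable_fun_past; lia.
(* Requiring 0 < B c' keeps Z + B c' nonnegative on the whole event without involving later clients,
   as [positive_services] would. *)
pose F' := F `&` [set x | 0 < B c' x].
have cF' : <<s cyl B c'.+1 >> F'.
  apply: past_setI; first exact: (past_mono (leqnSn c')).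
  by apply: past_lt => //; exact: past_cst.
have F'E : F' `&` Omega = F `&` Omega.
  apply/seteqP; split => x; first by move=> [[Fx _] Ox].
  by move=> [Fx Ox]; split => //; split => //; exact: Ox.
exists F', (fun x => Z x + B c' x); split => //.
- exact: measurable_funD.
- by move=> x [/Z0 ? /ltW ?]; rewrite addr_ge0.
- by rewrite F'E.
- split.
    move=> x HOx; have [Qx _] := HX _ HOx.
    have b0 : forall i, (0 < i <= n)%N -> 0 < B i x by case: HOx.
    have jn0 : (0 < j <= n)%N by lia.
    have mk1 : (0 < m < k)%N by lia.
    by rewrite (residual_sum tau_ge0 b0 jn0 kj Qx mk1) HZ.
  move=> v v0.
  have PF : P F' = P F.
    apply: (probability_eq_positive B_iid mu_gt0) => //.
      exact: (@past_measurable _ _ _ P B _ _ cF').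
    exact: (@past_measurable _ _ _ P B _ _ cF).
  rewrite PF -(Erlang_step mu_gt0 (@past_measurable _ _ _ P B c') _
      (fun A => service_exp B_iid cn' (A := A))
      (fun E A => past_indep B_iid cn' (E := E) (A := A)) cF mZ Z0 tailZ v0)//.
  have mlt := past_lt (@past_cst c'.+1 v) (measurable_funD mZ' mB).
  apply: (probability_eq_positive B_iid mu_gt0).
  + exact: (@past_measurable _ _ _ P B _ _ (past_setI cF' mlt)).
  + exact: (@past_measurable _ _ _ P B _ _ (past_setI (past_mono (leqnSn c') cF) mlt)).
  + by rewrite setIAC F'E setIAC.
Qed.

Let mOmega : measurable Omega := measurable_positive_services B n.

Let mQ j k : measurable [set x | Q j x = k].
Proof. exact: (measurable_queue_length tau (fun i => measurable_funPT (B i))). Qed.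

Let mres j k m : measurable_fun setT (fun x => res j k m x).
Proof. exact: (measurable_residual tau (fun i => measurable_funPT (B i))). Qed.

Lemma integral_positive_services (D : set T) (f : T -> \bar R) :
  measurable D -> measurable_fun setT f -> (forall x, 0 <= f x)%E ->
  (\int[P]_(x in D) f x = \int[P]_(x in D `&` Omega) f x)%E.
Proof.
move=> mD mf f0; have mO' : measurable (~` Omega) by exact: measurableC.
rewrite (ge0_negligible_integral mO' mD)//; last 2 first.
- exact: measurable_funTS.
- have := probability_setC P mOmega.
  by rewrite (probability_positive_services B_iid mu_gt0) subee.
by rewrite setDE setCK.
Qed.

Lemma renewal_tail j k H m v : renewal j k H -> (0 < m <= k)%N -> 0 <= v ->
  P (H `&` Omega `&` [set x | v < res j k m x]) = (P H * (pois_lt (mu * v) m)%:E)%E.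
Proof.
move=> rH mk v0; have [_ mH _] := rH.
have [E [Z [cE mZ _ HE [HZ tailZ]]]] := renewal_stage rH mk.
have mE := @past_measurable _ _ _ P B _ _ cE.
rewrite (probability_eq_positive B_iid mu_gt0 mH mE HE) -tailZ//.
apply: (probability_eq_positive B_iid mu_gt0).
- apply: measurableI; first exact: measurableI.
  rewrite -[X in measurable X]setTI.
  exact: (measurable_fun_ltr (measurable_cst v) (mres j k m) measurableT (Y := [set true])).
- have mlt := past_lt (@past_cst _ v) mZ.
  exact: (@past_measurable _ _ _ P B _ _ (past_setI cE mlt)).
- rewrite [RHS]setIAC -HE; apply/seteqP; split => x /= [].
    by move=> [HO vr] _; split => //; rewrite -HZ.
  by move=> HO vZ; split; [split => //; rewrite HZ|case: HO].
Qed.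

(** * One transition of the chain *)

Section step.
Variables (j k : nat) (H : set T).
Hypotheses (rH : renewal j k H) (jn : (j < n)%N).

Let mH : measurable H. Proof. by case: rH. Qed.
Let kj : (0 < k <= j)%N. Proof. by case: rH => -[]. Qed.
Let jn0 : (0 < j <= n)%N. Proof. by case: rH => -[]; lia. Qed.

Let HQ x : (H `&` Omega) x -> Q j x = k.
Proof. by case: rH => _ _ [E [X [_ _ _ _ HX]]] /HX[]. Qed.

Let nextP l x : (0 < l <= k.+1)%N -> (H `&` Omega) x ->
  reflect (Q j.+1 x = l)
    (((l == k.+1) || (res j k (k.+1 - l) x <= tau j k)) &&
     ((l == 1%N) || (tau j k < res j k (k.+2 - l) x))).
Proof.
move=> lk HOx; have b0 : forall i, (0 < i <= n)%N -> 0 < B i x by case: HOx.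
exact: (next_queue_lengthP tau_ge0 b0 jn0 kj (HQ HOx) jn lk).
Qed.

(** The new witnesses depend on who is in service. Without a departure (l = k + 1) it is the same
    client, with elapsed time X + tau. If all k clients have left (l = 1), client j + 1 starts at
    once, with elapsed time 0. Otherwise service began at departure m = k + 1 - l, and the elapsed
    time is tau - Z. In the last two cases E is cut with the past event Z <= tau. *)
Lemma renewal_next l : (0 < l <= k.+1)%N ->
  renewal j.+1 l (H `&` [set x | Q j.+1 x = l]).
Proof.
move=> lk; split; [by split; lia|exact: measurableI|].
set H1 := H `&` _.
have H1O x : (H1 `&` Omega) x -> (H `&` Omega) x /\ Q j.+1 x = l.
  by move=> [[Hx Qx] Ox].
have AS x : (H `&` Omega) x -> arrival tau (fun i => B i x) j.+1 =
    arrival tau (fun i => B i x) j + tau j k.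
  by move=> HOx; rewrite arrivalS ?(HQ HOx)//; lia.
have [lE|lN] := eqVneq l k.+1.
  have -> : (j.+1 - l).+1 = (j - k).+1 by lia.
  case: rH => _ _ [E [X [cE mX X0 HE HX]]].
  have mXt : measurable_fun (setT : set (past (j - k).+1))
      ((fun x => X x + tau j k) : past (j - k).+1 -> R).
    by apply: measurable_funD => //; exact: past_cst.
  exists E, (fun x => X x + tau j k); split => //.
  - by move=> x /X0 ?; rewrite addr_ge0 ?tau_ge0.
  - apply/seteqP; split => x.
      move=> /H1O[HOx Qx]; have [_ r1] := HX _ HOx.
      move: (HOx); rewrite HE => -[[Ex _] Ox]; split => //; split => //=.
      move/nextP : Qx => /(_ lk HOx); rewrite lE eqxx/= subSnn r1.
      by rewrite ltrBrDl; case: (k) kj.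
    move=> [[Ex /= h] Ox].
    have HOx : (H `&` Omega) x.
      rewrite HE; split => //; split => //=.
      by apply: le_lt_trans h; rewrite lerDl.
    have [_ r1] := HX _ HOx.
    split => //; split; first by case: HOx.
    apply/(nextP lk HOx); rewrite lE eqxx/= subSnn r1 ltrBrDl h.
    by rewrite orbT.
  - move=> x /H1O[HOx Qx]; split => //; have [_ r1] := HX _ HOx.
    move: r1; rewrite /residual (AS _ HOx) lE subSS => r1.
    by rewrite opprD addrA r1 opprD addrA.
have [m [m0 mE]] : exists m, (0 < m <= k)%N /\ m = (k.+1 - l)%N.
  by exists (k.+1 - l)%N; lia.
have [E [Z [cE mZ Z0 HE [HZ _]]]] := renewal_stage rH m0.
have -> : (j.+1 - l).+1 = (j - k + m).+1 by lia.
have cF : <<s cyl B (j - k + m).+1 >> (E `&` [set x | Z x <= tau j k]).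
  by apply: past_setI => //; exact: past_le mZ (@past_cst _ _).
have [l1|l1] := eqVneq l 1%N.
  exists (E `&` [set x | Z x <= tau j k]), (fun=> 0); split => //.
  - apply/seteqP; split => x.
      move=> /H1O[HOx Qx]; move: (HOx); rewrite HE => -[Ex Ox].
      move/nextP : Qx => /(_ lk HOx); rewrite (negbTE lN) -mE HZ//= => /andP[Zt _].
      by split => //; split; [split|apply: Ox; lia].
    move=> [[[Ex Zt] _] Ox].
    have HOx : (H `&` Omega) x by rewrite HE.
    split => //; split; first by case: HOx.
    by apply/(nextP lk HOx); rewrite (negbTE lN) -mE HZ// Zt l1.
  - move=> x /H1O[HOx Qx]; split => //.
    move/nextP : Qx => /(_ lk HOx); rewrite (negbTE lN) -mE/= => /andP[rt _].
    rewrite /residual (_ : j.+1 - l + 1 = j.+1)%N; last by lia.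
    rewrite (_ : (j - k + m).+1 = j.+1); last by lia.
    rewrite departureS max_l ?subr0; first by rewrite addrAC subrr add0r.
    move: rt; rewrite /residual lerBlDl (AS _ HOx).
    by rewrite (_ : j - k + m = j)%N//; lia.
have rS x : (H `&` Omega) x -> res j k m.+1 x = Z x + B (j - k + m).+1 x.
  move=> HOx; have b0 : forall i, (0 < i <= n)%N -> 0 < B i x by case: HOx.
  have mk : (0 < m < k)%N by lia.
  by rewrite (residual_sum tau_ge0 b0 jn0 kj (HQ HOx) mk) HZ.
have km : (k.+2 - l)%N = m.+1 by lia.
exists (E `&` [set x | Z x <= tau j k]), (fun x => tau j k - Z x); split => //.
- by apply: measurable_funB => //; exact: past_cst.
- by move=> x [_ /=]; rewrite subr_ge0.
- apply/seteqP; split => x.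
    move=> /H1O[HOx Qx]; move: (HOx); rewrite HE => -[Ex Ox].
    move/nextP : Qx => /(_ lk HOx).
    rewrite (negbTE lN) (negbTE l1) -mE km rS// HZ//= => /andP[Zt tZ].
    by split => //; split => //=; rewrite ltrBlDl.
  move=> [[[Ex Zt] /= tZ] Ox].
  have HOx : (H `&` Omega) x by rewrite HE.
  split => //; split; first by case: HOx.
  apply/(nextP lk HOx).
  by rewrite (negbTE lN) (negbTE l1) -mE km rS// HZ// Zt/= -ltrBlDl.
- move=> x /H1O[HOx Qx]; split => //.
  have := rS _ HOx; rewrite /residual (AS _ HOx) => rSx.
  rewrite (_ : j.+1 - l + 1 = j - k + m.+1)%N; last by lia.
  by rewrite opprD addrA rSx; ring.
Qed.

(** Having exactly k + 1 - l departures by the next arrival is the difference of two nested tail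
    events, as in [p_tail]. *)
Lemma renewal_next_prob l : (0 < l <= k.+1)%N ->
  P (H `&` [set x | Q j.+1 x = l]) = (P H * (p_ mu k l (tau j k))%:E)%E.
Proof.
move=> lk; set t := tau j k; have t0 : 0 <= t := tau_ge0 j k.
pose F m := H `&` Omega `&` [set x | t < res j k m x].
have mF m : measurable (F m).
  apply: measurableI; first exact: measurableI.
  rewrite -[X in measurable X]setTI.
  exact: (measurable_fun_ltr (measurable_cst t) (mres j k m) measurableT (Y := [set true])).
have [r r0 PH] : exists2 r, 0 <= r & P H = r%:E.
  by exists (fine (P H)); [exact/fine_ge0/measure_ge0|rewrite fineK// fin_num_measure].
have PF m : (0 < m <= k)%N -> P (F m) = (r * pois_lt (mu * t) m)%:E.
  by move=> mk; rewrite (renewal_tail rH mk t0) PH.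
(* The void bounds at l = 1 and l = k + 1 become the whole event and the empty set. *)
pose G1 := if l == 1%N then H `&` Omega else F (k.+2 - l)%N.
pose G0 := if l == k.+1 then set0 else F (k.+1 - l)%N.
have mG1 : measurable G1 by rewrite /G1; case: ifP => // _; exact: measurableI.
have mG0 : measurable G0 by rewrite /G0; case: ifP.
have PG1 : P G1 = (r * (if l == 1%N then 1 else pois_lt (mu * t) (k.+2 - l)))%:E.
  rewrite /G1; case: eqP => l1; last by apply: PF; lia.
  rewrite mulr1 -PH; apply: (probability_eq_positive B_iid mu_gt0) => //.
    exact: measurableI.
  by rewrite -setIA setIid.
have PG0 : P G0 = (r * pois_lt (mu * t) (k.+1 - l))%:E.
  rewrite /G0; case: eqP => [->|lN]; last by apply: PF; lia.
  by rewrite subnn pois_lt0 mulr0 measure0.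
have G01 : G0 `<=` G1.
  rewrite /G0 /G1; case: eqP => lk1 //; case: eqP => l1; first by move=> x [].
  move=> x [HOx /= tr]; split => //=; apply: lt_le_trans tr _.
  have b0 : forall i, (0 < i <= n)%N -> 0 < B i x by case: HOx.
  by rewrite /residual lerB//; apply: (departure_le _ b0); lia.
have -> : P (H `&` [set x | Q j.+1 x = l]) = P (G1 `\` G0).
  apply: (probability_eq_positive B_iid mu_gt0).
  - exact: measurableI.
  - exact: measurableD.
  - apply/seteqP; split => x.
      move=> [[Hx Qx] Ox]; have HOx : (H `&` Omega) x by [].
      move/nextP : Qx => /(_ lk HOx)/andP[h0 h1]; split => //; split.
        by move: h1; rewrite /G1; case: eqP.
      move: h0; rewrite /G0; case: eqP => [_ _ []|_ /= rt [_ /=]].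
      by rewrite ltNge rt.
    move=> [[G1x G0x] Ox]; have HOx : (H `&` Omega) x.
      by move: G1x; rewrite /G1; case: ifP => // _ [].
    split => //; split; first by case: HOx.
    apply/(nextP lk HOx)/andP; split.
      move: G0x; rewrite /G0; case: eqP => //= _ G0x.
      by rewrite leNgt; apply/negP => tr; apply: G0x.
    by move: G1x; rewrite /G1; case: eqP => //= _ [].
have -> : P (G1 `\` G0) = (P G1 - P G0)%E.
  have := measureD (mu := P) mG1 mG0; rewrite (setIidr G01); apply.
  by rewrite ltey_eq fin_num_measure.
rewrite PG1 PG0 PH -EFinB -EFinM p_tail//.
by congr EFin; rewrite mulrBr.
Qed.

(** D may be smaller than H: besides the cost over H itself, this splits the integral over H cut
    with {Q i = k} and, for f = 1, the probability of that event. *)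
Lemma integral_next (D : set T) (f : T -> \bar R) :
  measurable D -> D `<=` H -> measurable_fun setT f -> (forall x, 0 <= f x)%E ->
  (\int[P]_(x in D) f x =
   \sum_(1 <= l < k.+2) \int[P]_(x in D `&` [set x | Q j.+1 x = l]) f x)%E.
Proof.
move=> mD DH mf f0; rewrite integral_positive_services//.
have mDO : measurable (D `&` Omega) by exact: measurableI.
transitivity (\int[P]_(x in D `&` Omega)
    (\sum_(1 <= l < k.+2) (f \_ [set x | Q j.+1 x = l]) x))%E.
  apply: eq_integral => x /set_mem[Dx Ox].
  have b0 : forall i, (0 < i <= n)%N -> 0 < B i x by [].
  have Qx := next_queue_length_bounds tau_ge0 b0 jn0 kj (HQ (conj (DH _ Dx) Ox)) jn.
  rewrite (bigD1_seq (Q j.+1 x)) ?iota_uniq//=; last by rewrite mem_index_iota; lia.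
  rewrite patchE mem_set//= big1 ?adde0// => l /eqP lQ.
  by rewrite patchE memNset//= => Ql; apply: lQ.
rewrite ge0_integral_sum//; last 2 first.
- move=> l; apply: measurable_funTS; apply/(measurable_restrictT _ (mQ _ _)).
  exact: measurable_funTS.
- by move=> l x _; apply: erestrict_ge0.
apply: eq_bigr => l _; rewrite -integral_mkcondr setIAC.
by rewrite [RHS]integral_positive_services//; exact: measurableI.
Qed.

Let integral_residual m (t : R) : (0 < m <= k)%N -> 0 <= t ->
  (\int[P]_(x in H `&` Omega) (Num.min t (res j k m x))%:E = P H * (mean_min mu m t)%:E)%E.
Proof.
move=> mk t0; have mHO : measurable (H `&` Omega) by exact: measurableI.
have PHO : P (H `&` Omega) = P H.
  apply: (probability_eq_positive B_iid mu_gt0) => //.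
  by rewrite -setIA setIid.
rewrite -PHO; apply: integral_min_Erlang => //.
- move=> x HOx; apply/ltW.
  have b0 : forall i, (0 < i <= n)%N -> 0 < B i x by case: HOx.
  exact: (residual_gt0 tau_ge0 b0 jn0 kj (HQ HOx)).
- by move=> v v0; rewrite PHO renewal_tail.
Qed.

Let mHO : measurable (H `&` Omega). Proof. exact: measurableI. Qed.

Let residual_min_ge0 m (t : R) x : (0 < m <= k)%N -> 0 <= t -> (H `&` Omega) x ->
  0 <= Num.min t (res j k m x).
Proof.
move=> mk t0 HOx; rewrite le_min t0/=; apply/ltW.
have b0 : forall i, (0 < i <= n)%N -> 0 < B i x by case: HOx.
exact: (residual_gt0 tau_ge0 b0 jn0 kj (HQ HOx)).
Qed.

Let mmin m (t : R) : measurable_fun setT (fun x => Num.min t (res j k m x)).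
Proof. by apply: measurable_minr => //; exact: measurable_cst. Qed.

Let fin_P : exists2 r, 0 <= r & P H = r%:E.
Proof.
by exists (fine (P H)); [exact/fine_ge0/measure_ge0|rewrite fineK// fin_num_measure].
Qed.

Let integral_idle (t : R) : 0 <= t ->
  (\int[P]_(x in H `&` Omega) (t - Num.min t (res j k k x))%:E = P H * (f_ mu k t)%:E)%E.
Proof.
move=> t0; have kk : (0 < k <= k)%N by lia.
have := integral_residual kk t0; have [r r0 PH] := fin_P; rewrite PH => Ik.
have PHO : P (H `&` Omega) = r%:E.
  rewrite -PH; apply: (probability_eq_positive B_iid mu_gt0) => //.
  by rewrite -setIA setIid.
have : (\int[P]_(x in H `&` Omega) ((t - Num.min t (res j k k x))%:E +
    (Num.min t (res j k k x))%:E) = (t * r)%:E)%E.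
  transitivity (\int[P]_(x in H `&` Omega) (cst t%:E x))%E.
    by apply: eq_integral => x _; rewrite -EFinD subrK.
  by rewrite integral_cst// EFinM; congr (_ * _)%E; exact: PHO.
rewrite ge0_integralD//; last 4 first.
- by move=> x _; rewrite lee_fin subr_ge0 ge_min lexx.
- apply/measurable_EFinP; apply: measurable_funTS.
  by apply: measurable_funB; [exact: measurable_cst|exact: mmin].
- by move=> x HOx; rewrite lee_fin residual_min_ge0.
- by apply/measurable_EFinP; exact: measurable_funTS.
(* I plus a finite quantity equals t r, which forces I to be finite before it is solved for. *)
rewrite Ik f_E//; set I := (\int[P]_(x in _) _)%E; move: I => -[I| |]//=.
by rewrite -!EFinM -EFinD => -[h]; congr EFin; rewrite mulrBr -[X in _ = X - _]mulrC -h addrK.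
Qed.

Lemma renewal_step_cost (om : R) : 0 <= om <= 1 ->
  let t := tau j k in
  (\int[P]_(x in H `&` Omega) (om * (t - Num.min t (res j k k x)) +
      (1 - om) * \sum_(1 <= m < k) Num.min t (res j k m x))%:E
   = P H * (om * f_ mu k t + (1 - om) * g_ mu k t)%:E)%E.
Proof.
move=> /andP[om0 om1] t; have t0 : 0 <= t := tau_ge0 j k.
have om1' : 0 <= 1 - om by rewrite subr_ge0.
have sum0 x : (H `&` Omega) x -> 0 <= \sum_(1 <= m < k) Num.min t (res j k m x).
  move=> HOx; rewrite big_nat; apply: sumr_ge0 => m mk; apply: residual_min_ge0 => //.
  by lia.
have msum : measurable_fun setT (fun x => \sum_(1 <= m < k) Num.min t (res j k m x)).
  by apply: measurable_sum.
have mid : measurable_fun setT (fun x => t - Num.min t (res j k k x)).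
  by apply: measurable_funB; [exact: measurable_cst|exact: mmin].
have -> : (\int[P]_(x in H `&` Omega) (om * (t - Num.min t (res j k k x)) +
      (1 - om) * \sum_(1 <= m < k) Num.min t (res j k m x))%:E =
   \int[P]_(x in H `&` Omega) (om%:E * (t - Num.min t (res j k k x))%:E +
      (1 - om)%:E * (\sum_(1 <= m < k) Num.min t (res j k m x))%:E))%E.
  by apply: eq_integral => x _; rewrite EFinD !EFinM.
rewrite ge0_integralD//; last 4 first.
- by move=> x _; rewrite -EFinM lee_fin mulr_ge0// subr_ge0 ge_min lexx.
- by apply: measurable_funeM; apply/measurable_EFinP; exact: measurable_funTS.
- by move=> x HOx; rewrite -EFinM lee_fin mulr_ge0// sum0.
- by apply: measurable_funeM; apply/measurable_EFinP; exact: measurable_funTS.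
have mfid : measurable_fun (H `&` Omega) (fun x => (t - Num.min t (res j k k x))%:E).
  by apply/measurable_EFinP; exact: measurable_funTS.
have mfsum : measurable_fun (H `&` Omega)
    (fun x => (\sum_(1 <= m < k) Num.min t (res j k m x))%:E).
  by apply/measurable_EFinP; exact: measurable_funTS.
have id0 x : (H `&` Omega) x -> (0 <= (t - Num.min t (res j k k x))%:E)%E.
  by move=> _; rewrite lee_fin subr_ge0 ge_min lexx.
have sum0' x : (H `&` Omega) x ->
    (0 <= (\sum_(1 <= m < k) Num.min t (res j k m x))%:E)%E.
  by move=> HOx; rewrite lee_fin sum0.
rewrite (ge0_integralZl_EFin _ mHO id0 mfid om0) (ge0_integralZl_EFin _ mHO sum0' mfsum om1').
rewrite integral_idle//.
(* The maximum with 0 makes the summands nonnegative for every index m, as the interchange of sum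
   and integral demands; for 1 <= m < k it changes nothing on this domain. *)
have -> : (\int[P]_(x in H `&` Omega) (\sum_(1 <= m < k) Num.min t (res j k m x))%:E =
   \sum_(1 <= m < k) \int[P]_(x in H `&` Omega) (Num.min t (Num.max (res j k m x) 0))%:E)%E.
  rewrite -ge0_integral_sum//; last 2 first.
  - move=> m; apply/measurable_EFinP; apply: measurable_funTS.
    apply: measurable_minr; first exact: measurable_cst.
    by apply: measurable_maxr => //; exact: measurable_cst.
  - by move=> m x _; rewrite lee_fin le_min t0 le_max lexx orbT.
  apply: eq_integral => x /set_mem HOx; rewrite sumEFin; congr EFin.
  rewrite big_nat [RHS]big_nat; apply: eq_bigr => m mk.
  congr Num.min; rewrite max_l//; apply/ltW.
  have b0 : forall i, (0 < i <= n)%N -> 0 < B i x by case: HOx.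
  by apply: (residual_gt0 tau_ge0 b0 jn0 kj (HQ HOx)); lia.
have -> : (\sum_(1 <= m < k) \int[P]_(x in H `&` Omega) (Num.min t (Num.max (res j k m x) 0))%:E
    = P H * (g_ mu k t)%:E)%E.
  rewrite g_E//; last by lia.
  have [r r0 PH] := fin_P.
  rewrite PH -EFinM mulr_sumr -sumEFin big_nat [RHS]big_nat; apply: eq_bigr => m mk.
  have mk' : (0 < m <= k)%N by lia.
  rewrite EFinM -PH -integral_residual//; apply: eq_integral => x /set_mem HOx.
  congr (Num.min _ _)%:E; rewrite max_l//; apply/ltW.
  have b0 : forall i, (0 < i <= n)%N -> 0 < B i x by case: HOx.
  exact: (residual_gt0 tau_ge0 b0 jn0 kj (HQ HOx)).
have [r r0 ->] := fin_P.
by rewrite -!EFinM -EFinD; congr EFin; ring.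
Qed.

End step.

Lemma renewal_last_cost (om : R) k H : 0 <= om <= 1 -> renewal n k H ->
  (\int[P]_(x in H `&` Omega) ((1 - om) * \sum_(1 <= m < k) res n k m x)%:E
   = P H * ((1 - om) * (k%:R * (k%:R - 1) / (2 * mu)))%:E)%E.
Proof.
move=> /andP[_ om1] rH; have [[kn _] mH [E [X [_ _ _ _ HX]]]] := rH.
have om1' : 0 <= 1 - om by rewrite subr_ge0.
have k0 : (0 < k)%N by lia.
have nn : (0 < n <= n)%N by lia.
have mHO : measurable (H `&` Omega) by exact: measurableI.
have [r r0 PH] : exists2 r, 0 <= r & P H = r%:E.
  by exists (fine (P H)); [exact/fine_ge0/measure_ge0|rewrite fineK// fin_num_measure].
have PHO : P (H `&` Omega) = P H.
  apply: (probability_eq_positive B_iid mu_gt0) => //.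
  by rewrite -setIA setIid.
have res0 m x : (0 < m < k)%N -> (H `&` Omega) x -> 0 <= res n k m x.
  move=> mk HOx; have b0 : forall i, (0 < i <= n)%N -> 0 < B i x by case: HOx.
  by apply/ltW; apply: (residual_gt0 tau_ge0 b0 nn kn (HX _ HOx).1); lia.
have Im m : (0 < m < k)%N -> (\int[P]_(x in H `&` Omega) (Num.max (res n k m x) 0)%:E =
    (r * (m%:R / mu))%:E)%E.
  move=> mk; rewrite EFinM -PH -PHO -(@integral_Erlang _ _ _ _ _ (fun x => res n k m x))//.
  - by apply: eq_integral => x /set_mem HOx; rewrite max_l// res0.
  - by move=> x HOx; exact: res0.
  - by move=> v v0; rewrite PHO renewal_tail//; lia.
rewrite -(sum_Erlang_means mu_gt0)// PH.
transitivity (\int[P]_(x in H `&` Omega)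
    ((1 - om)%:E * \sum_(1 <= m < k) (Num.max (res n k m x) 0)%:E))%E.
  apply: eq_integral => x /set_mem HOx; rewrite sumEFin -EFinM; congr (_ * _)%:E.
  rewrite big_nat [RHS]big_nat; apply: eq_bigr => m mk.
  by rewrite max_l// res0.
rewrite ge0_integralZl_EFin//; last 2 first.
- by move=> x _; apply: sume_ge0 => m _; rewrite lee_fin le_max lexx orbT.
- apply: emeasurable_sum => m; apply/measurable_EFinP; apply: measurable_funTS.
  by apply: measurable_maxr => //; exact: measurable_cst.
rewrite ge0_integral_sum//; last 2 first.
- move=> m; apply/measurable_EFinP; apply: measurable_funTS.
  by apply: measurable_maxr => //; exact: measurable_cst.
- by move=> m x _; rewrite lee_fin le_max lexx orbT.
have -> : (\sum_(1 <= m < k) \int[P]_(x in H `&` Omega) (Num.max (res n k m x) 0)%:E =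
    (r * \sum_(1 <= m < k) (m%:R / mu))%:E)%E.
  rewrite mulr_sumr -sumEFin big_nat [RHS]big_nat; apply: eq_bigr => m mk.
  exact: Im.
by rewrite -!EFinM; congr EFin; ring.
Qed.

(** * The expected cost of a fixed policy *)

Variable om : R.
Hypothesis om01 : 0 <= om <= 1.

(* The expected cost of the policy tau from the arrival of client j onwards, given
   that k clients are then present; r is the number n - j of clients yet to arrive. *)
Fixpoint policy_cost (r j k : nat) : R :=
  if r is r'.+1 then
    om * f_ mu k (tau j k) + (1 - om) * g_ mu k (tau j k) +
    \sum_(1 <= l < k.+2) p_ mu k l (tau j k) * policy_cost r' j.+1 l
  else (1 - om) * (k%:R * (k%:R - 1) / (2 * mu)).

Let Cost i x := cost tau (fun l => B l x) om n i.

Let mCost i : measurable_fun setT (Cost i).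
Proof. exact: (measurable_cost tau (fun l => measurable_funPT (B l))). Qed.

Let Cost_ge0 i x : (0 <= Cost i x)%E.
Proof. exact: (cost_ge0 tau (fun l => B l) n i x om01). Qed.

(** The factor does not depend on H, which is the Markov property. H stays arbitrary in the
    induction because the hypothesis is applied to H cut with {Q (j + 1) = l}. *)
Lemma renewal_cost r j k H : (r + j)%N = n -> renewal j k H ->
  (\int[P]_(x in H) Cost j x = P H * (policy_cost r j k)%:E)%E.
Proof.
elim: r j k H => [|r IH] j k H rj rH.
  have jE : j = n by lia.
  subst j; have [[kn _] mH [E [X [_ _ _ _ HX]]]] := rH.
  rewrite integral_positive_services// -(renewal_last_cost om01 rH).
  apply: eq_integral => x /set_mem HOx.
  have b0 : forall i, (0 < i <= n)%N -> 0 < B i x by case: HOx.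
  by rewrite /Cost (cost_last tau_ge0 b0 om kn (HX _ HOx).1).
have jn : (j < n)%N by lia.
have [[kj _] mH [E [X [_ _ _ _ HX]]]] := rH.
have jn' : (0 < j < n)%N by lia.
have mHO : measurable (H `&` Omega) by exact: measurableI.
rewrite integral_positive_services//.
have om1 : 0 <= 1 - om by move: om01 => /andP[_]; rewrite subr_ge0.
have om0 : 0 <= om by move: om01 => /andP[].
transitivity (\int[P]_(x in H `&` Omega)
  ((om * (tau j k - Num.min (tau j k) (res j k k x)) +
    (1 - om) * \sum_(1 <= m < k) Num.min (tau j k) (res j k m x))%:E + Cost j.+1 x))%E.
  apply: eq_integral => x /set_mem HOx.
  have b0 : forall i, (0 < i <= n)%N -> 0 < B i x by case: HOx.
  by rewrite /Cost (cost_step tau_ge0 b0 om01 jn' kj (HX _ HOx).1).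
rewrite ge0_integralD//; last 3 first.
- move=> x HOx; rewrite lee_fin addr_ge0//.
    by rewrite mulr_ge0// subr_ge0 ge_min lexx.
  rewrite mulr_ge0// big_nat; apply: sumr_ge0 => m mk; rewrite le_min tau_ge0/=.
  have b0 : forall i, (0 < i <= n)%N -> 0 < B i x by case: HOx.
  have jn0 : (0 < j <= n)%N by lia.
  by apply/ltW; apply: (residual_gt0 tau_ge0 b0 jn0 kj (HX _ HOx).1); lia.
- have mm m : measurable_fun setT (fun x => Num.min (tau j k) (res j k m x)).
    by apply: measurable_minr => //; exact: measurable_cst.
  apply/measurable_EFinP; apply: measurable_funTS; apply: measurable_funD.
    apply: measurable_funM; first exact: measurable_cst.
    by apply: measurable_funB; [exact: measurable_cst|exact: mm].
  apply: measurable_funM; first exact: measurable_cst.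
  by apply: measurable_sum => m; exact: mm.
- exact: measurable_funTS.
rewrite (renewal_step_cost rH jn om01) -integral_positive_services//.
rewrite (integral_next rH jn mH (@subset_refl _ H) (mCost j.+1) (Cost_ge0 j.+1)).
have [a a0 PH] : exists2 a, 0 <= a & P H = a%:E.
  by exists (fine (P H)); [exact/fine_ge0/measure_ge0|rewrite fineK// fin_num_measure].
have -> : (\sum_(1 <= l < k.+2) \int[P]_(x in H `&` [set x | Q j.+1 x = l]) Cost j.+1 x =
   (a * \sum_(1 <= l < k.+2) p_ mu k l (tau j k) * policy_cost r j.+1 l)%:E)%E.
  rewrite mulr_sumr -sumEFin big_nat [RHS]big_nat; apply: eq_bigr => l lk.
  have lk' : (0 < l <= k.+1)%N by lia.
  rewrite (IH _ _ _ _ (renewal_next rH jn lk')); last by lia.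
  by rewrite (renewal_next_prob rH jn lk') PH -!EFinM mulrA.
by rewrite PH -!EFinM -EFinD -mulrDr.
Qed.

(** Runs the chain from arrival j up to arrival i, splitting H by the queue length at each arrival.
    All pieces that end in state k have the same factor, so they add up; pieces that end elsewhere
    are null. *)
Lemma renewal_queue_cost r j k0 H i k : (r + j)%N = i -> (i <= n)%N ->
  renewal j k0 H ->
  (\int[P]_(x in H `&` [set x | Q i x = k]) Cost i x =
   P (H `&` [set x | Q i x = k]) * (policy_cost (n - i) i k)%:E)%E.
Proof.
elim: r j k0 H => [|r IH] j k0 H rj iN rH.
  have jE : j = i by lia.
  subst j; have [_ mH [E [X [_ _ _ _ HX]]]] := rH.
  have [<-|k0k] := eqVneq k0 k.
    have HE : H `&` [set x | Q i x = k0] `&` Omega = H `&` Omega.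
      apply/seteqP; split => x; first by move=> [[]].
      by move=> HOx; have [Qx _] := HX _ HOx; case: HOx.
    have mHQ : measurable (H `&` [set x | Q i x = k0]) by exact: measurableI.
    rewrite integral_positive_services// HE -integral_positive_services//.
    rewrite (probability_eq_positive B_iid mu_gt0 mHQ mH HE).
    by apply: renewal_cost => //; lia.
  have mHQ : measurable (H `&` [set x | Q i x = k]) by exact: measurableI.
  have HE : H `&` [set x | Q i x = k] `&` Omega = set0 `&` Omega.
    rewrite set0I -subset0 => x [[Hx Qx] Ox].
    have [Qx' _] := HX _ (conj Hx Ox).
    by move/eqP: k0k; apply; rewrite -Qx' Qx.
  rewrite integral_positive_services// HE set0I integral_set0.
  by rewrite (probability_eq_positive B_iid mu_gt0 mHQ measurable0 HE) measure0 mul0e.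
have jn : (j < n)%N by lia.
have [_ mH _] := rH.
have mHQ : measurable (H `&` [set x | Q i x = k]) by exact: measurableI.
rewrite (integral_next rH jn mHQ (@subIsetl _ _ _) (mCost i) (Cost_ge0 i)).
(* The same splitting as for the cost, applied to the constant function 1. *)
have -> : P (H `&` [set x | Q i x = k]) = (\sum_(1 <= l < k0.+2)
    P (H `&` [set x | Q i x = k] `&` [set x | Q j.+1 x = l]))%E.
  have := integral_next rH jn mHQ (@subIsetl _ _ _) (@measurable_cst _ _ _ _ setT 1%E)
    (fun=> lee01).
  rewrite integral_cst// mul1e => ->; apply: eq_bigr => l _.
  by rewrite integral_cst ?mul1e//; exact: measurableI.
rewrite ge0_sume_distrl; last by move=> l _; exact: measure_ge0.
rewrite big_nat [RHS]big_nat; apply: eq_bigr => l lk.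
have lk' : (0 < l <= k0.+1)%N by lia.
have := IH _ _ _ _ iN (renewal_next rH jn lk').
rewrite setIAC; apply; lia.
Qed.

Lemma queue_event_cost i k : (0 < i <= n)%N ->
  (\int[P]_(x in queue_event B tau i k) Cost i x =
   P (queue_event B tau i k) * (policy_cost (n - i) i k)%:E)%E.
Proof.
move=> iN; have n0 : (0 < n)%N by lia.
have := @renewal_queue_cost i.-1 1 1 setT i k _ _ (renewal_first n0).
by rewrite setTI; apply; lia.
Qed.

Lemma expected_costE i k : (0 < i <= n)%N -> (0 < P (queue_event B tau i k))%E ->
  expected_cost B om n tau i k = (policy_cost (n - i) i k)%:E.
Proof.
move=> iN P0; rewrite /expected_cost.
have := queue_event_cost k iN; rewrite /Cost => ->.
have fP : P (queue_event B tau i k) \is a fin_num.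
  by apply: fin_num_measure; exact: mQ.
rewrite -[P _ in X in (_ * X)%E]fineK// -!EFinM mulrA mulVf ?mul1r//.
by rewrite gt_eqF// fine_gt0// P0 -ge0_fin_numE.
Qed.

End markov.

(** * Dynamic programming *)

Section dynamic_programming.
Context {R : realType}.
Variables (mu om : R).
Hypothesis mu_gt0 : 0 < mu.
Hypothesis om01 : 0 <= om <= 1.

Lemma sum_p k t : 0 <= t -> \sum_(1 <= l < k.+2) p_ mu k l t = 1.
Proof.
move=> t0; rewrite big_nat_recl// p_1// (_ : \sum_(1 <= i < k.+1) _ = pois_lt (mu * t) k).
  by rewrite subrK.
rewrite big_nat_rev /= big_add1/= big_mkord; apply: eq_bigr => i _.
have ik := ltn_ord i.
have -> : (1 + k.+1 - i.+2).+1 = (k - i.+1).+2 by lia.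
by rewrite p_S; congr pois_wt; lia.
Qed.

Definition stage_cost (h : nat -> R) (k : nat) (t : R) : R :=
  om * f_ mu k t + (1 - om) * g_ mu k t + \sum_(1 <= l < k.+2) p_ mu k l t * h l.

(** The recursion of the theorem in real numbers, indexed by the number r = n - i of clients yet to
    arrive. That [inf] is a genuine infimum is the content of [stage_cost_has_inf]. *)
Fixpoint value (r k : nat) : R :=
  if r is r'.+1 then inf [set stage_cost (value r') k t | t in [set t | 0 <= t]]
  else (1 - om) * (k%:R * (k%:R - 1) / (2 * mu)).

Lemma stage_cost_ge0 h k t : (0 < k)%N -> 0 <= t -> (forall l, (0 < l)%N -> 0 <= h l) ->
  0 <= stage_cost h k t.
Proof.
move=> k0 t0 h0; move: om01 => /andP[om0 om1].
have om1' : 0 <= 1 - om by rewrite subr_ge0.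
rewrite addr_ge0//; first by rewrite addr_ge0// mulr_ge0// ?f_ge0 ?g_ge0.
by rewrite big_nat; apply: sumr_ge0 => l lk; rewrite mulr_ge0 ?p_ge0 ?h0//; lia.
Qed.

Lemma stage_cost_le h h' k t : 0 <= t -> (forall l, (0 < l)%N -> h l <= h' l) ->
  stage_cost h k t <= stage_cost h' k t.
Proof.
move=> t0 hh'; rewrite lerD2l big_nat [leRHS]big_nat; apply: ler_sum => l lk.
by apply: ler_wpM2l; [apply: p_ge0 => //; lia|apply: hh'; lia].
Qed.

(** The transition probabilities sum to 1, so a uniform excess in the next values passes through
    unchanged. *)
Lemma stage_costD h e k t : 0 <= t ->
  stage_cost (fun l => h l + e) k t = stage_cost h k t + e.
Proof.
move=> t0; rewrite /stage_cost -[in RHS]addrA; congr (_ + _).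
under eq_bigr do rewrite mulrDr.
by rewrite big_split/= -mulr_suml sum_p// mul1r.
Qed.

Lemma value_ge0 r k : (0 < k)%N -> 0 <= value r k.
Proof.
elim: r k => [|r IH] k k0 /=.
  move: om01 => /andP[_ om1].
  by rewrite mulr_ge0 ?subr_ge0// divr_ge0 ?mulr_ge0 ?subr_ge0 ?ler1n// ltW.
apply: lb_le_inf; first by exists (stage_cost (value r) k 0); exists 0 => /=.
by move=> _ [t t0 <-]; apply: stage_cost_ge0.
Qed.

Lemma stage_cost_has_inf r k : (0 < k)%N ->
  has_inf [set stage_cost (value r) k t | t in [set t | 0 <= t]].
Proof.
move=> k0; split; first by exists (stage_cost (value r) k 0); exists 0 => /=.
exists 0 => _ [t t0 <-]; apply: stage_cost_ge0 => // l; exact: value_ge0.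
Qed.

(** The one-step infimum is below any choice, and [stage_cost] is monotone in the next values. *)
Lemma value_le_policy_cost (tau : nat -> nat -> R) r j k : policy tau -> (0 < k)%N ->
  value r k <= policy_cost tau mu om r j k.
Proof.
move=> tau0; elim: r j k => [|r IH] j k k0 //.
apply: (@le_trans _ _ (stage_cost (value r) k (tau j k))).
  apply: ge_inf; first by have [] := stage_cost_has_inf r k0.
  by exists (tau j k) => //; exact: tau0.
by apply: stage_cost_le => [|l l0]; [exact: tau0|exact: IH].
Qed.

(** Each of the r remaining decisions adds at most e, and by [stage_costD] later excesses are
    carried back without growth. *)
Lemma policy_cost_le_value (tau : nat -> nat -> R) (e : R) n i : policy tau ->
  (forall r j k, (r.+1 + j)%N = n -> (i <= j)%N -> (0 < k)%N ->
     stage_cost (value r) k (tau j k) <= value r.+1 k + e) ->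
  forall r j k, (r + j)%N = n -> (i <= j)%N -> (0 < k)%N ->
  policy_cost tau mu om r j k <= value r k + r%:R * e.
Proof.
move=> tau0 htau; elim=> [|r IH] j k rj ij k0; first by rewrite mul0r addr0.
apply: (@le_trans _ _ (stage_cost (fun l => value r l + r%:R * e) k (tau j k))).
  apply: stage_cost_le => [|l l0]; first exact: tau0.
  by apply: IH => //; lia.
rewrite stage_costD; last exact: tau0.
have -> : value r.+1 k + r.+1%:R * e = value r.+1 k + e + r%:R * e.
  by rewrite -[r.+1%:R]natr1; ring.
by rewrite lerD2r htau.
Qed.

Lemma exists_almost_optimal (e : R) n i : 0 < e ->
  exists2 tau : nat -> nat -> R, policy tau /\ (forall j k, (j < i)%N -> tau j k = 1) &
  forall r j k, (r.+1 + j)%N = n -> (i <= j)%N -> (0 < k)%N ->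
    stage_cost (value r) k (tau j k) <= value r.+1 k + e.
Proof.
move=> e0.
have ex (rk : nat * nat) : exists t : R, 0 <= t /\ ((0 < rk.2)%N ->
    stage_cost (value rk.1) rk.2 t <= value rk.1.+1 rk.2 + e).
  have [k0|k0] := posnP rk.2; first by exists 0; split => //; rewrite k0.
  have [_ [t t0 <-] te] := inf_adherent e0 (stage_cost_has_inf rk.1 k0).
  by exists t; split => // _; exact: ltW.
have [opt hopt] := choice ex.
(* Once client j + 1 has arrived, (n - j) - 1 clients are yet to arrive; this is the index r of the
   next values. *)
exists (fun j k => if (j < i)%N then 1 else opt ((n - j).-1, k)).
  split; last by move=> j k ->.
  by move=> j k; case: ifP => // _; have [] := hopt ((n - j).-1, k).
move=> r j k rj ij k0; rewrite ltnNge ij/=.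
have -> : (n - j).-1 = r by lia.
by have [_ /(_ k0)] := hopt (r, k).
Qed.

End dynamic_programming.

(** * The recursion computes the optimal cost *)

Section optimal_cost_value.
Context {R : realType} {d : measure_display} {T : measurableType d}.
Variables (P : probability T R) (B : nat -> {RV P >-> R}) (n : nat) (mu om : R).
Hypothesis mu_gt0 : 0 < mu.
Hypothesis om01 : 0 <= om <= 1.
Hypothesis B_iid : iid_exponential B n mu.

Lemma queue_event_gt0 (tau : nat -> nat -> R) i k : policy tau ->
  (0 < k <= i)%N -> (i <= n)%N -> (forall j k, (j < i)%N -> tau j k = 1) ->
  (0 < P (queue_event B tau i k))%E.
Proof.
move=> tau0 ki iN tau1.
have [H rH PH] : exists2 H, renewal B n tau i k H & (0 < P H)%E.
  elim: i k ki iN tau1 => [|i IH] k ki iN tau1; first by lia.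
  have [i0|i0] := posnP i.
    subst i; have -> : k = 1%N by lia.
    by exists setT; [exact: renewal_first tau0 _|rewrite probability_setT].
  (* State k is entered from k - 1 without a departure, or from 1 when k = 1; every transition up to
     k' + 1 has positive probability after a gap of length 1. *)
  pose k' := maxn k.-1 1.
  have k'i : (0 < k' <= i)%N by rewrite /k'; lia.
  have [H rH PH] : exists2 H, renewal B n tau i k' H & (0 < P H)%E.
    by apply: IH => //; [lia|move=> j l ji; apply: tau1; lia].
  have kk' : (0 < k <= k'.+1)%N by rewrite /k'; lia.
  exists (H `&` [set x | queue_length tau (fun j => B j x) i.+1 = k]).
    exact: (renewal_next tau0 mu_gt0 B_iid rH).
  rewrite (renewal_next_prob tau0 mu_gt0 B_iid rH)// mule_gt0// lte_fin p_gt0//; first by lia.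
  by rewrite tau1.
have [_ mH [E [X [_ _ _ _ HX]]]] := rH.
have mO := measurable_positive_services B n.
have mHO : measurable (H `&` positive_services B n) by exact: measurableI.
apply: lt_le_trans PH _.
rewrite (probability_eq_positive B_iid mu_gt0 mH mHO); last by rewrite -setIA setIid.
apply: le_measure; rewrite ?inE//; last by move=> x /HX[].
exact: (measurable_queue_length tau (fun j => measurable_funPT (B j))).
Qed.

Lemma optimal_cost_value i k : (0 < k <= i)%N -> (i <= n)%N ->
  optimal_cost B om n i k = (value mu om (n - i) k)%:E.
Proof.
move=> ki iN; have iN' : (0 < i <= n)%N by lia.
have k0 : (0 < k)%N by lia.
apply/eqP; rewrite eq_le; apply/andP; split; last first.
  apply: le_ereal_inf_tmp => _ [tau [tau0 Ptau] <-].
  by rewrite (expected_costE tau0 mu_gt0 B_iid om01)// lee_fin value_le_policy_cost.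
apply/lee_addgt0Pr => e e0.
(* At most n decisions remain, so errors of e/(n + 1) sum to at most e. *)
have e'0 : 0 < e / n.+1%:R by rewrite divr_gt0.
have [tau [tau0 tau1] htau] := exists_almost_optimal mu_gt0 om01 n i e'0.
have Ptau := queue_event_gt0 tau0 ki iN tau1.
apply: (@le_trans _ _ (expected_cost B om n tau i k)).
  by apply: ereal_inf_lbound; exists tau.
rewrite (expected_costE tau0 mu_gt0 B_iid om01)// -EFinD lee_fin.
have nin : (n - i + i)%N = n by lia.
apply: le_trans (policy_cost_le_value mu_gt0 om01 tau0 htau nin (leqnn i) k0) _.
rewrite lerD2l mulrCA ger_pMr// ler_pdivrMr// mul1r ler_nat; lia.
Qed.

End optimal_cost_value.

Theorem theorem1 (R : realType) (n : nat) (mu om : R)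
    (d : measure_display) (T : measurableType d) (P : probability T R)
    (B : nat -> {RV P >-> R})
    (mu_gt0 : 0 < mu) (om_ge0 : 0 <= om) (om_le1 : om <= 1)
    (B_iid : iid_exponential B n mu) :
  (forall i k : nat, (1 <= i < n)%N -> (1 <= k <= i)%N ->
     optimal_cost B om n i k =
     ereal_inf [set ((om * f_ mu k t + (1 - om) * g_ mu k t)%:E
                     + \sum_(1 <= l < k.+2)
                         (p_ mu k l t)%:E * optimal_cost B om n i.+1 l)%E
               | t in [set t : R | 0 <= t]]) /\
  (forall k : nat, (1 <= k <= n)%N ->
     [/\ g_ mu k t @[t --> +oo] --> k%:R * (k%:R - 1) / (2 * mu),
         optimal_cost B om n n k =
           ((1 - om) * lim (g_ mu k t @[t --> +oo]))%:E &
         optimal_cost B om n n k =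
           ((1 - om) * (k%:R * (k%:R - 1) / (2 * mu)))%:E]).
Proof.
have om01 : 0 <= om <= 1 by rewrite om_ge0.
split=> [i k iN ki|k kn]; last first.
  have k0 : (0 < k)%N by lia.
  have gk := cvgy_g mu_gt0 k0.
  have -> : optimal_cost B om n n k = ((1 - om) * (k%:R * (k%:R - 1) / (2 * mu)))%:E.
    by rewrite (optimal_cost_value mu_gt0 om01 B_iid)// subnn.
  by split => //; rewrite (cvg_lim _ gk).
have k0 : (0 < k)%N by lia.
rewrite (optimal_cost_value mu_gt0 om01 B_iid ki); last by lia.
have -> : (n - i)%N = (n - i.+1).+1 by lia.
(* The set is nonempty and bounded below, so its infimum in the reals agrees with the extended
   one. *)
have [ne lb] := stage_cost_has_inf mu_gt0 om01 (n - i.+1) k0.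
rewrite /= -ereal_inf_EFin//; congr ereal_inf; rewrite image_comp.
apply: eq_imagel => t t0; rewrite /= /stage_cost EFinD -sumEFin; congr (_ + _)%E.
apply: eq_big_nat => l lk.
rewrite (optimal_cost_value mu_gt0 om01 B_iid) ?EFinM//; lia.
Qed.
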